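(* Let $G=\ast_{j\in J} A_j$ be a free product of nontrivial groups and let $n$ be a positive integer. If $a\in A_{j_1}$ and $t\in A_{j_2}$ are nonidentity elements with $j_1\neq j_2$ and $\mathrm{ord}(a)\le \mathrm{ord}(t)$, then $$\mathrm{cl}([a,t]^n) = \left\lfloor \frac{n}{2}\right\rfloor - \left\lfloor \frac{n}{\mathrm{ord}(a)}\right\rfloor + 1.$$
   Context: $[x,y]=x^{-1}y^{-1}xy$. The commutator length $\mathrm{cl}(h)$ of an element $h$ of the commutator subgroup of a group is the minimal $k$ such that $h$ is a product of $k$ commutators. $\mathrm{ord}(a)$ is the order of $a$ (possibly $\infty$); if $\mathrm{ord}(a)=\infty$, the term $\lfloor n/\mathrm{ord}(a)\rfloor$ is interpreted as $0$. $\lfloor x\rfloor$ denotes the integer part of $x$. *)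

(* Defs.v *)
From Stdlib Require Import Arith List.
Import ListNotations.

Record group := Group {
  carrier :> Type;
  gmul : carrier -> carrier -> carrier;
  gone : carrier;
  ginv : carrier -> carrier;
  gmulA : forall x y z, gmul x (gmul y z) = gmul (gmul x y) z;
  gmul1l : forall x, gmul gone x = x;
  gmul1r : forall x, gmul x gone = x;
  gmulVl : forall x, gmul (ginv x) x = gone;
  gmulVr : forall x, gmul x (ginv x) = gone
}.

Arguments gmul {g} _ _.
Arguments gone {g}.
Arguments ginv {g} _.

Record hom (G H : group) := Hom {
  hmap :> G -> H;
  hmapM : forall x y, hmap (gmul x y) = gmul (hmap x) (hmap y)
}.
Arguments hmap {G H} _ _.

Definition is_free_product (J : Type) (A : J -> group) (G : group)
    (inj : forall j, hom (A j) G) : Prop :=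
  forall (H : group) (f : forall j, hom (A j) H),
    exists phi : hom G H,
      (forall j (x : A j), phi (inj j x) = f j x) /\
      (forall psi : hom G H, (forall j (x : A j), psi (inj j x) = f j x) ->
         forall g, psi g = phi g).

Definition nontrivial (G : group) : Prop := exists x : G, x <> gone.

Fixpoint gpow {G : group} (x : G) (n : nat) : G :=
  match n with
  | 0 => gone
  | S m => gmul x (gpow x m)
  end.

Definition comm {G : group} (x y : G) : G :=
  gmul (ginv x) (gmul (ginv y) (gmul x y)).

Fixpoint prod_comm {G : group} (l : list (G * G)) : G :=
  match l with
  | [] => gone
  | (x, y) :: l' => gmul (comm x y) (prod_comm l')
  end.

Definition comm_length {G : group} (h : G) (k : nat) : Prop :=
  (exists l : list (G * G), length l = k /\ prod_comm l = h) /\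
  (forall l : list (G * G), prod_comm l = h -> k <= length l).

Definition has_order {G : group} (x : G) (o : option nat) : Prop :=
  match o with
  | Some m => 0 < m /\ gpow x m = gone /\
              (forall k, 0 < k < m -> gpow x k <> gone)
  | None => forall k, 0 < k -> gpow x k <> gone
  end.

Definition ord_le (o1 o2 : option nat) : Prop :=
  match o1, o2 with
  | _, None => True
  | None, Some _ => False
  | Some m, Some k => m <= k
  end.

(* floor(n / ord), interpreted as 0 when ord is infinite *)
Definition div_ord (n : nat) (o : option nat) : nat :=
  match o with
  | Some m => n / m
  | None => 0
  end.

(* Main.v *)
From Pilot Require Import Defs.
From Stdlib Require Import Arith List Lia.
From mathcomp Require all_boot fingroup perm boolp zify.
Import ListNotations.

(** Write [a,t] = A c with A = a^-1 and c = t^-1 a t.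

    Upper bound: modulo one commutator, three consecutive syllable pairs
    A^i c^j merge into one ([merge3]), and five of them collapse when three of
    the A-exponents and three of the c-exponents cancel ([merge5]).  Hence a
    power w^M of w = A c, with M = ord a or M = 2 ord a, is congruent to
    A^e (A^-e)^(w^j) modulo M/2 - M/ord a commutators ([period]), and this
    expression is absorbed by the remaining factor of w^n.

    Lower bound: a surface of genus k bounded by a cyclic word
    a_1 b_1 ... a_m b_m in a free product of two groups is cut along the
    preimage of the wedge point into pieces lying over one factor each.  The
    gluing is a factorisation of the cyclic shift of the indices as
    al \o be; the orbits of al (of be) are the boundary cycles over the first
    (second) factor, and an orbit can bound a disc only if its label product
    is trivial.  Comparing Euler characteristics gives
    (number of such orbits) >= m + 1 - 2k.  In [a,t]^n an orbit either changes
    sign, or has length at least the order of its letter; counting sign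
    changes bounds the number of orbits by n + 2 floor(n / ord a), where m = 2n. *)

Declare Scope grp_scope.
Delimit Scope grp_scope with grp.
Notation "x * y" := (gmul x y) : grp_scope.
Notation "x ^-1" := (ginv x) (at level 1, left associativity, format "x ^-1") : grp_scope.
Notation "x ** n" := (gpow x n) (at level 30, right associativity) : grp_scope.
Open Scope grp_scope.

(** * Elementary identities for products, inverses and powers *)

Section GroupBasics.
Context {G : group}.
Implicit Types x y z g h : G.

Lemma mulKV x y : x^-1 * (x * y) = y.
Proof. now rewrite gmulA, gmulVl, gmul1l. Qed.
Lemma mulVK x y : x * (x^-1 * y) = y.
Proof. now rewrite gmulA, gmulVr, gmul1l. Qed.
Lemma mul_cancel_l x y z : x * y = x * z -> y = z.
Proof. intros H; now rewrite <- (mulKV x y), H, mulKV. Qed.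
Lemma inv_unique x y : x * y = gone -> y = x^-1.
Proof. intros H; apply (mul_cancel_l x); now rewrite H, gmulVr. Qed.
Lemma inv_mul x y : (x * y)^-1 = y^-1 * x^-1.
Proof. symmetry; apply inv_unique; now rewrite <- gmulA, mulVK, gmulVr. Qed.
Lemma inv_inv x : (x^-1)^-1 = x.
Proof. symmetry; apply inv_unique; apply gmulVl. Qed.
Lemma inv_one : (gone : G)^-1 = gone.
Proof. symmetry; apply inv_unique; apply gmul1l. Qed.
Lemma mulA_r x y z : (x * y) * z = x * (y * z).
Proof. now rewrite gmulA. Qed.
End GroupBasics.

Ltac gsimp :=
  repeat rewrite ?inv_mul, ?inv_inv, ?inv_one, ?mulA_r, ?mulKV, ?mulVK,
    ?gmulVl, ?gmulVr, ?gmul1l, ?gmul1r.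
Ltac gsolve := unfold comm; gsimp; reflexivity.

Section Powers.
Context {G : group}.
Implicit Types x y z g h : G.

Lemma pow_add x m n : x ** (m + n) = x ** m * x ** n.
Proof. induction m as [|m IH]; simpl; [now rewrite gmul1l | now rewrite IH, gmulA]. Qed.
Lemma pow_1 x : x ** 1 = x.
Proof. apply gmul1r. Qed.
Lemma pow_comm x m n : x ** m * x ** n = x ** n * x ** m.
Proof. now rewrite <- !pow_add, Nat.add_comm. Qed.
Lemma pow_succ_r x n : x * x ** n = x ** n * x.
Proof. generalize (pow_comm x 1 n); now rewrite pow_1. Qed.
Lemma pow_conj x g n : (g^-1 * (x * g)) ** n = g^-1 * (x ** n * g).
Proof.
  induction n as [|n IH]; simpl; [now gsimp|].
  rewrite IH; gsolve.
Qed.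
Lemma pow_inv x n : (x^-1) ** n = (x ** n)^-1.
Proof.
  apply inv_unique; induction n as [|n IH]; simpl; [apply gmul1l|].
  rewrite pow_succ_r at 1; gsimp; exact IH.
Qed.
Lemma pow_complement x N e : x ** N = gone -> e <= N -> x ** (N - e) = (x ** e)^-1.
Proof.
  intros HN He; apply inv_unique; rewrite <- pow_add.
  now replace (e + (N - e)) with N by lia.
Qed.
End Powers.

(** * Products of [k] commutators and congruence modulo such products *)

Definition comm_prod {G : group} (k : nat) (g : G) : Prop :=
  exists l : list (G * G), length l = k /\ prod_comm l = g.

Definition eq_mod {G : group} (k : nat) (x y : G) : Prop := comm_prod k (x * y^-1).

Section CommProd.
Context {G : group}.
Implicit Types x y z g h : G.

Lemma prod_comm_app (l1 l2 : list (G * G)) :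
  prod_comm (l1 ++ l2) = prod_comm l1 * prod_comm l2.
Proof.
  induction l1 as [|[x y] l1 IH]; simpl; [now rewrite gmul1l|].
  now rewrite IH, gmulA.
Qed.
Lemma comm_prod0 : comm_prod 0 (gone : G).
Proof. now exists []. Qed.
Lemma comm_prod1 x y : comm_prod 1 (comm x y).
Proof. exists [(x, y)]; simpl; now rewrite gmul1r. Qed.
Lemma comm_prod_mul k l x y : comm_prod k x -> comm_prod l y -> comm_prod (k + l) (x * y).
Proof.
  intros (u & Hu & <-) (v & Hv & <-); exists (u ++ v); split.
  - rewrite length_app; lia.
  - apply prod_comm_app.
Qed.
Lemma comm_prod_conj k x g : comm_prod k x -> comm_prod k (g^-1 * (x * g)).
Proof.
  intros (u & Hu & <-).
  exists (map (fun p => (g^-1 * (fst p * g), g^-1 * (snd p * g))) u); split.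
  - now rewrite length_map.
  - clear Hu; induction u as [|[x y] u IH]; simpl; [now gsimp|].
    rewrite IH; gsolve.
Qed.
Lemma comm_prod_conj_pair x g h : comm_prod 1 (g^-1 * (x * g) * (h^-1 * (x^-1 * h))).
Proof.
  replace (_ * _) with (comm (g^-1 * (x^-1 * g)) (g^-1 * h)) by gsolve.
  apply comm_prod1.
Qed.

Lemma eq_mod_of_eq x y : x = y -> eq_mod 0 x y.
Proof. intros ->; unfold eq_mod; rewrite gmulVr; apply comm_prod0. Qed.
Lemma eq_mod_trans k l x y z : eq_mod k x y -> eq_mod l y z -> eq_mod (k + l) x z.
Proof.
  intros Hx Hy; unfold eq_mod; replace (x * z^-1) with (x * y^-1 * (y * z^-1)) by gsolve.
  now apply comm_prod_mul.
Qed.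
(** The error [y * y'^-1] is conjugated past [x], which keeps its number of commutators. *)
Lemma eq_mod_mul k l x x' y y' :
  eq_mod k x x' -> eq_mod l y y' -> eq_mod (k + l) (x * y) (x' * y').
Proof.
  intros Hx Hy; unfold eq_mod; rewrite Nat.add_comm.
  replace (x * y * (x' * y')^-1)
    with ((x^-1)^-1 * (y * y'^-1 * x^-1) * (x * x'^-1)) by gsolve.
  apply comm_prod_mul; [now apply comm_prod_conj | easy].
Qed.
Lemma eq_mod_conj k x y g : eq_mod k x y -> eq_mod k (g^-1 * (x * g)) (g^-1 * (y * g)).
Proof.
  intros H; unfold eq_mod.
  replace (_ * _) with (g^-1 * (x * y^-1 * g)) by gsolve.
  now apply comm_prod_conj.
Qed.
Lemma eq_mod_mull k x y g : eq_mod k x y -> eq_mod k (g * x) (g * y).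
Proof. intros H; apply (eq_mod_mul 0 k); [now apply eq_mod_of_eq | easy]. Qed.
Lemma eq_mod_mulr k x y g : eq_mod k x y -> eq_mod k (x * g) (y * g).
Proof.
  intros H; rewrite <- (Nat.add_0_r k); apply eq_mod_mul; [easy | now apply eq_mod_of_eq].
Qed.
Lemma eq_mod_comm_prod k l x y : eq_mod k x y -> comm_prod l y -> comm_prod (k + l) x.
Proof.
  intros H Hy; replace x with (x * y^-1 * y) by gsolve; now apply comm_prod_mul.
Qed.

(** Writing [q'] as [z^-1 * (q' * z)] makes both sides end in [z]. Their quotient is then a
    conjugate of [u] times a conjugate of [u^-1]; the second commutation rule gives two expressions
    for [u], and both are used. *)
Lemma merge3 (z p q p' q' : G) : z * q' = q' * z -> p * p' = p' * p ->
  eq_mod 1 (z * (p * (q * (p' * q')))) (p * (p' * (q * (q' * z)))).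
Proof.
  intros Hz Hp.
  replace (z * (p * (q * (p' * q')))) with (z * (p * (q * (p' * (z^-1 * (q' * z))))))
    by (now rewrite <- Hz; gsimp).
  unfold eq_mod.
  set (u := p'^-1 * (p^-1 * (z * p))); set (g := z * (p * (q * (p' * z^-1)))).
  assert (Hu : u = p^-1 * (p'^-1 * (z * p))).
  { subst u; rewrite !gmulA, <- !inv_mul; now rewrite Hp. }
  replace (_ * _) with
    ((q * g^-1)^-1 * (u * (q * g^-1)) *
     ((p^-1 * (p'^-1 * g^-1))^-1 * (u^-1 * (p^-1 * (p'^-1 * g^-1))))).
  - apply comm_prod_conj_pair.
  - rewrite Hu at 2; subst u g; gsolve.
Qed.

(** Once the two relations eliminate [a3] and [c3], the quotient of the sides is a conjugate of
    [x^-1] times a conjugate of [x], where [x = c0 * (a1 * c1)]. *)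
Lemma merge5 (a0 c0 a1 c1 a2 c2 a3 c3 a4 c4 : G) :
  a1 * (a4 * a3) = gone -> c0 * (c3 * c1) = gone ->
  eq_mod 1 (a0 * (c0 * (a1 * (c1 * (a2 * (c2 * (a3 * (c3 * (a4 * c4)))))))))
    (a0 * (c0 * (a1 * c1)) * (a2 * (a0 * ((a0 * (c0 * (a1 * c1)))^-1 * (c2 * c4))))).
Proof.
  intros Ha Hc.
  assert (Ha3 : a3 = a4^-1 * a1^-1).
  { apply (mul_cancel_l a4), (mul_cancel_l a1); rewrite Ha; now gsimp. }
  assert (Hc3 : c3 = c0^-1 * c1^-1).
  { apply (mul_cancel_l c0); rewrite mulVK; rewrite <- (gmul1l _ (c1^-1)), <- Hc; now gsimp. }
  subst a3 c3; unfold eq_mod.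
  set (x := c0 * (a1 * c1)); set (v := a0 * (x * a2)).
  set (g := c0 * (a1 * (a4 * (c2^-1 * v^-1)))); set (h := a0^-1 * v^-1).
  replace (_ * _) with (g^-1 * (x^-1 * g) * (h^-1 * ((x^-1)^-1 * h)))
    by (subst g h v x; gsolve).
  apply comm_prod_conj_pair.
Qed.
End CommProd.

(** * Powers of a product [A * c] whose factors have a common exponent *)

Section PowersOfProduct.
Context {G : group}.
Implicit Types A c y z : G.

(* The exponent [m] may differ from [n] by a multiple of the common order of [A] and [c]. *)
Definition split_pow A c (g n m i : nat) : Prop :=
  eq_mod g ((A * c) ** n) (A ** m * (((A * c) ** i)^-1 * (c ** m * (A * c) ** i))).

(** The exponent [e] is kept free so that it can be matched with the exponent of the power that is
    multiplied on the right. *)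
Definition period A c (h M e j : nat) : Prop :=
  eq_mod h ((A * c) ** M)
    (A ** e * (((A * c) ** j)^-1 * ((A ** e)^-1 * (A * c) ** j))).

(** Two further factors cost one commutator: [merge3] carries both new letters [A] to the left of
    [c ** p]. *)
Lemma pow_odd A c m :
  eq_mod m ((A * c) ** (2 * m + 1)) (A ** (2 * m + 1) * c ** (2 * m + 1)).
Proof.
  induction m as [|m IH].
  - apply eq_mod_of_eq; simpl; now gsimp.
  - replace (2 * S m + 1) with (2 * m + 1 + 2) by lia.
    set (p := 2 * m + 1) in *; replace (S m) with (m + 1) by lia.
    eapply eq_mod_trans.
    + rewrite pow_add; apply eq_mod_mulr; exact IH.
    + rewrite (pow_add A).
      replace (A ** p * c ** p * (A * c) ** 2)
        with (A ** p * (c ** p * (A * (c * (A * c))))) by (simpl; gsolve).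
      replace (A ** p * A ** 2 * c ** (p + 2))
        with (A ** p * (A * (A * (c * (c * c ** p)))))
        by (rewrite (Nat.add_comm p); simpl; gsolve).
      apply eq_mod_mull, merge3; [symmetry; apply pow_succ_r | reflexivity].
Qed.

Lemma split_pow_odd A c m : split_pow A c m (2 * m + 1) (2 * m + 1) 0.
Proof. unfold split_pow; change ((A * c) ** 0) with (gone : G); gsimp; apply pow_odd. Qed.

(** For an odd exponent [N = 2 * mu + 3] of [A] and [c], this supplies the even values of [m] that
    [split_pow_odd] cannot give, at the price of [N] extra factors. *)
Lemma split_pow_odd_order A c mu rho :
  A ** (2 * mu + 3) = gone -> c ** (2 * mu + 3) = gone ->
  split_pow A c (mu + rho + 1) (2 * mu + 3 + (2 * rho + 2)) (2 * rho + 2) 2.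
Proof.
  intros HA Hc; set (w := A * c); set (s := 2 * rho + 1); set (u := 2 * mu + 1).
  assert (H : eq_mod (mu + rho + 1) (w ** (2 * mu + 3 + (2 * rho + 2)))
                (w ** 2 * (A ** (2 * rho + 2) * ((w ** 2)^-1 * c ** (2 * rho + 2))))).
  (* The power is cut into blocks of lengths [1, 1, s, u, 1]. The two long blocks cost [rho + mu]
     commutators and [merge5] costs one. The second, fourth and fifth [A]-exponents add up to
     [1 + u + 1 = 2 * mu + 3], and so do the first, second and fourth [c]-exponents. *)
  { eapply eq_mod_trans with
      (y := A * (c * (A * (c * (A ** s * (c ** s * (A ** u * (c ** u * (A * c))))))))).
    - replace (2 * mu + 3 + (2 * rho + 2)) with (2 + (s + (u + 1))) by lia.
      rewrite !pow_add, pow_1.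
      replace (A * _) with (w ** 2 * (A ** s * c ** s * (A ** u * c ** u * w)))
        by (subst w; simpl; gsolve).
      apply eq_mod_mull; rewrite Nat.add_comm; apply eq_mod_mul; [apply pow_odd|].
      apply eq_mod_mulr, pow_odd.
    - replace (2 * rho + 2) with (s + 1) by lia.
      replace (w ** 2 * _) with
        (A * (c * (A * c)) * (A ** s * (A * ((A * (c * (A * c)))^-1 * (c ** s * c)))))
        by (rewrite !pow_add, !pow_1; subst w; simpl; gsolve).
      apply merge5.
      + change (A ** (2 + u) = gone); now replace (2 + u) with (2 * mu + 3) by lia.
      + rewrite <- pow_succ_r.
        change (c ** (2 + u) = gone); now replace (2 + u) with (2 * mu + 3) by lia. }
  apply (eq_mod_conj _ _ _ (w ** 2)) in H.
  unfold split_pow; fold w.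
  rewrite (pow_comm w _ 2), mulKV in H; rewrite !mulA_r, mulKV in H.
  exact H.
Qed.

(** Conjugation by [c] turns powers of [c * A] into powers of [A * c]. The index grows by one
    because conjugating [A ** m] by [c] is the same as conjugating it by [A * c]. *)
Lemma split_pow_swap A c g n m i : split_pow c A g n m i ->
  eq_mod g ((A * c) ** n)
    (c ** m * (((A * c) ** (i + 1))^-1 * (A ** m * (A * c) ** (i + 1)))).
Proof.
  intros H; apply (eq_mod_conj _ _ _ c) in H; rewrite <- pow_conj in H.
  assert (Hi : (c * A) ** i * c = c * (A * c) ** i).
  { replace (A * c) with (c^-1 * (c * A * c)) by gsolve.
    rewrite pow_conj; gsolve. }
  assert (Hi' : ((c * A) ** i)^-1 = c * (((A * c) ** i)^-1 * c^-1)).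
  { replace ((c * A) ** i) with (c * ((A * c) ** i * c^-1)).
    - gsolve.
    - rewrite gmulA, <- Hi; gsolve. }
  replace (A * c) with (c^-1 * (c * A * c)) at 1 by gsolve.
  replace (c ** m * _)
    with (c^-1 * (c ** m * (((c * A) ** i)^-1 * (A ** m * (c * A) ** i)) * c)); [exact H|].
  rewrite !mulA_r, Hi, Hi', Nat.add_1_r; simpl.
  assert (conj_pow : forall x : G, x^-1 * (x ** m * x) = x ** m)
    by (intros x; rewrite <- pow_succ_r; gsolve).
  rewrite <- (conj_pow A) at 1.
  transitivity (c^-1 * (c ** m * c) *
    (((A * c) ** i)^-1 * (c^-1 * (A^-1 * (A ** m * (A * (c * (A * c) ** i))))))); [gsolve|].
  rewrite conj_pow; gsolve.
Qed.

(** The first power ends in a conjugate of [c ** m1]. The second, with the roles of the letters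
    swapped and conjugated by [w ** i1] for [w = A * c], begins with the same conjugate of
    [c ** m2]. These cancel because [m1 + m2 = N]. *)
Lemma period_of_split A c N g1 n1 m1 i1 g2 n2 m2 i2 :
  A ** N = gone -> c ** N = gone -> m1 + m2 = N ->
  split_pow A c g1 n1 m1 i1 -> split_pow c A g2 n2 m2 i2 ->
  period A c (g1 + g2) (n1 + n2) m1 (i1 + (i2 + 1)).
Proof.
  intros HA Hc Hm H1 H2; apply split_pow_swap in H2.
  apply (eq_mod_conj _ _ _ ((A * c) ** i1)) in H2.
  replace (((A * c) ** i1)^-1 * ((A * c) ** n2 * (A * c) ** i1))
    with ((A * c) ** n2) in H2 by (rewrite (pow_comm _ n2 i1); gsolve).
  unfold period; rewrite pow_add.
  generalize (eq_mod_mul _ _ _ _ _ _ H1 H2).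
  assert (Em : m2 = N - m1) by lia.
  assert (HAm : A ** m2 = (A ** m1)^-1)
    by (rewrite Em; apply pow_complement; [easy | lia]).
  assert (Hcm : c ** m2 = (c ** m1)^-1)
    by (rewrite Em; apply pow_complement; [easy | lia]).
  rewrite HAm, Hcm, Nat.add_comm with (n := i1), (pow_add _ (i2 + 1) i1).
  gsimp; easy.
Qed.

(* [w^n] commutes with [w^j], so it can be moved next to the factor [A^-e]. *)
Lemma period_absorb A c h M e j g n y :
  period A c h M e j -> eq_mod g ((A * c) ** n) (A ** e * y) ->
  eq_mod (h + g) ((A * c) ** (M + n))
    (A ** e * (((A * c) ** j)^-1 * (y * (A * c) ** j))).
Proof.
  intros HM Hn; rewrite pow_add; eapply eq_mod_trans; [apply eq_mod_mulr; exact HM|].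
  replace (_ * (A * c) ** n)
    with (A ** e * (((A * c) ** j)^-1 * ((A ** e)^-1 * ((A * c) ** n * (A * c) ** j))))
    by (rewrite (pow_comm _ n j); gsolve).
  replace (y * (A * c) ** j) with ((A ** e)^-1 * ((A ** e * y) * (A * c) ** j)) by gsolve.
  now do 3 apply eq_mod_mull; apply eq_mod_mulr.
Qed.

(** The product telescopes: absorbing one more period only lengthens the conjugating power from
    [j * q] to [j * q + j]. *)
Lemma period_mul A c h M e j q :
  period A c h M e j -> period A c (h * q) (M * q) e (j * q).
Proof.
  intros H; induction q as [|q IH].
  - rewrite !Nat.mul_0_r; apply eq_mod_of_eq; simpl; now gsimp.
  - rewrite !(Nat.mul_comm _ (S q)); simpl; rewrite !(Nat.mul_comm q).
    unfold period; eapply (period_absorb _ _ _ _ _ _ _ _ _ H) in IH.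
    rewrite (Nat.add_comm j), (pow_add _ (j * q) j); gsimp.
    rewrite !mulA_r in IH; exact IH.
Qed.

(** An even exponent is the sum of two odd numbers, the first of which can be prescribed; both parts
    come from [split_pow_odd]. *)
Lemma period_even A c nu x : A ** (2 * nu) = gone -> c ** (2 * nu) = gone ->
  x < nu -> period A c (nu - 1) (2 * nu) (2 * x + 1) 1.
Proof.
  intros HA Hc Hx.
  assert (H := period_of_split A c _ x _ (2 * x + 1) _ _ _ (2 * (nu - x - 1) + 1) _ HA Hc
    ltac:(lia) (split_pow_odd A c x) (split_pow_odd c A (nu - x - 1))).
  replace (nu - 1) with (x + (nu - x - 1)) by lia.
  now replace (2 * nu)%nat with (2 * x + 1 + (2 * (nu - x - 1) + 1)) by lia.
Qed.

(** For an odd exponent [N], one of [e] and [N - e] is odd and the other even. The even one is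
    obtained from [split_pow_odd_order], whose [N] extra factors make the length of the period
    [2 * N]. *)
Lemma period_odd A c mu e : A ** (2 * mu + 3) = gone -> c ** (2 * mu + 3) = gone ->
  0 < e < 2 * mu + 3 -> period A c (2 * mu + 1) (2 * (2 * mu + 3)) e 3.
Proof.
  intros HA Hc He; destruct (Nat.Even_or_Odd e) as [[x Hx]|[x Hx]].
  - assert (H := period_of_split A c _ _ _ (2 * (x - 1) + 2) _ _ _ (2 * (mu - (x - 1)) + 1) _ HA Hc
      ltac:(lia) (split_pow_odd_order A c mu (x - 1) HA Hc)
      (split_pow_odd c A (mu - (x - 1)))).
    replace (2 * (2 * mu + 3))%nat with
      (2 * mu + 3 + (2 * (x - 1) + 2) + (2 * (mu - (x - 1)) + 1)) by lia.
    replace (2 * mu + 1) with (mu + (x - 1) + 1 + (mu - (x - 1))) by lia.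
    now replace e with (2 * (x - 1) + 2) by lia.
  - assert (H := period_of_split A c _ _ _ (2 * x + 1) _ _ _ (2 * (mu - x) + 2) _ HA Hc
      ltac:(lia) (split_pow_odd A c x)
      (split_pow_odd_order c A mu (mu - x) Hc HA)).
    replace (2 * (2 * mu + 3))%nat with
      (2 * x + 1 + (2 * mu + 3 + (2 * (mu - x) + 2))) by lia.
    replace (2 * mu + 1) with (x + (mu + (mu - x) + 1)) by lia.
    now rewrite Hx.
Qed.

End PowersOfProduct.

(** * The upper bound, where [c] is a conjugate of the inverse of [A] *)

Section UpperBound.
Context {G : group}.
Variables a t : G.
Let A := a^-1.
Let c := t^-1 * (a * t).

Lemma commE : comm a t = A * c.
Proof. subst A c; gsolve. Qed.

Lemma pow_c n : c ** n = t^-1 * ((A ** n)^-1 * t).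
Proof. subst A c; rewrite pow_conj, pow_inv; gsolve. Qed.

Lemma split_pow_comm_prod (r : nat) (z : G) :
  comm_prod 1 (A ** r * (z^-1 * (c ** r * z))).
Proof.
  rewrite pow_c.
  replace (_ * _) with (gone^-1 * (A ** r * gone) * ((t * z)^-1 * ((A ** r)^-1 * (t * z))))
    by gsolve.
  apply comm_prod_conj_pair.
Qed.

Lemma period_comm_prod h M e j : period A c h M e j -> comm_prod (h + 1) ((A * c) ** M).
Proof.
  intros H; apply (eq_mod_comm_prod _ _ _ _ H).
  replace (_ * _) with (gone^-1 * (A ** e * gone) *
    (((A * c) ** j)^-1 * ((A ** e)^-1 * (A * c) ** j))) by gsolve.
  apply comm_prod_conj_pair.
Qed.

Lemma period_split_comm_prod h M e j g n i q :
  period A c h M e j -> split_pow A c g n e i ->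
  comm_prod (h * q + g + 1) ((A * c) ** (M * q + n)).
Proof.
  intros HM Hn; apply (period_mul _ _ _ _ _ _ q) in HM.
  eapply eq_mod_comm_prod; [apply (period_absorb _ _ _ _ _ _ _ _ _ HM Hn)|].
  replace (_ * _) with
    (A ** e * (((A * c) ** i * (A * c) ** (j * q))^-1 *
       (c ** e * ((A * c) ** i * (A * c) ** (j * q))))) by gsolve.
  apply split_pow_comm_prod.
Qed.

(** The case of an odd multiple of an odd exponent [N]. One factor [w] is set aside in front, and
    the remaining [w ** (N - 1)] starts with [A ** 1], so that it absorbs periods with [e = 1]. *)
Lemma pow_odd_multiple_comm_prod mu q :
  A ** (2 * mu + 3) = gone -> c ** (2 * mu + 3) = gone ->
  comm_prod ((2 * mu + 1) * q + mu + 1)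
    ((A * c) ** (2 * (2 * mu + 3) * q + (2 * mu + 3))).
Proof.
  intros HA Hc.
  assert (HM := period_mul _ _ _ _ _ _ q (period_odd A c mu 1 HA Hc ltac:(lia))).
  set (w := A * c) in *; set (N := 2 * mu + 3) in *.
  assert (H2 : eq_mod mu (w ** (N - 1)) (A ** 1 * (c * (A ** (N - 2) * c ** (N - 2))))).
  { replace (N - 1) with (1 + (2 * mu + 1)) by lia; rewrite pow_add, !pow_1.
    replace (A * (c * _)) with (w * (A ** (N - 2) * c ** (N - 2))) by (subst w; gsolve).
    apply eq_mod_mull; replace (N - 2) with (2 * mu + 1) by lia; apply pow_odd. }
  assert (H3 := period_absorb _ _ _ _ _ _ _ _ _ HM H2).
  apply (eq_mod_mull _ _ _ w) in H3.
  replace (2 * N * q + N) with (1 + (2 * N * q + (N - 1))) by lia.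
  rewrite (pow_add w 1), pow_1.
  apply (eq_mod_comm_prod _ _ _ _ H3).
  rewrite !pow_complement by (assumption || lia).
  (* What remains is [A c A] followed by a conjugate of [c A^-2 c^-2]; the former is a conjugate of
     [x], the latter of [x^-1]. *)
  set (x := c * (A * A)); set (z := w ** (3 * q)).
  replace (w * _) with
    ((A^-1)^-1 * (x * A^-1) * ((c^-1 * z)^-1 * (x^-1 * (c^-1 * z)))).
  - apply comm_prod_conj_pair.
  - subst x w; simpl; gsolve.
Qed.

(** With [2 * m + 1 = N * q + r], the remainder is matched with a period whose [e] is [r]. For odd
    [N] the periods have length [2 * N], so an odd [q] leaves a remaining power of length
    [N + r]. *)
Lemma comm_pow_odd_upper N m : 2 <= N -> a ** N = gone ->
  comm_prod (m - (2 * m + 1) / N + 1) ((A * c) ** (2 * m + 1)).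
Proof.
  intros HN Ha.
  assert (HA : A ** N = gone) by (subst A; now rewrite pow_inv, Ha, inv_one).
  assert (Hc : c ** N = gone) by (rewrite pow_c, HA; now gsimp).
  assert (Hd := Nat.div_mod (2 * m + 1) N ltac:(lia)).
  assert (Hr := Nat.mod_upper_bound (2 * m + 1) N ltac:(lia)).
  revert Hd Hr; generalize ((2 * m + 1) / N) ((2 * m + 1) mod N); intros q r Hd Hr.
  destruct (Nat.Even_or_Odd N) as [[nu Hnu]|[nu Hnu]].
  - rewrite Hd; rewrite Hnu, <- Nat.mul_assoc in Hd.
    destruct (Nat.Even_or_Odd r) as [[x Hx]|[x Hx]]; [exfalso; lia|].
    rewrite Hnu in *; rewrite Hx in *.
    replace (m - q + 1) with ((nu - 1) * q + x + 1) by nia.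
    eapply period_split_comm_prod; [|apply split_pow_odd].
    apply period_even; [easy|easy|lia].
  - assert (exists mu, N = 2 * mu + 3) as [mu Hmu] by (exists (nu - 1); lia).
    clear nu Hnu; rewrite Hd, Hmu in *.
    destruct (Nat.Even_or_Odd q) as [[p Hp]|[p Hp]]; rewrite Hp in *.
    + destruct (Nat.Even_or_Odd r) as [[x Hx]|[x Hx]]; [exfalso; nia|rewrite Hx in *].
      replace (m - 2 * p + 1) with ((2 * mu + 1) * p + x + 1) by nia.
      replace ((2 * mu + 3) * (2 * p))%nat with (2 * (2 * mu + 3) * p)%nat by lia.
      eapply period_split_comm_prod; [|apply split_pow_odd].
      apply period_odd; [easy|easy|lia].
    + destruct (Nat.Even_or_Odd r) as [[x Hx]|[x Hx]]; [rewrite Hx in *|exfalso; nia].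
      destruct x as [|x].
      (* Here [r = 0], while [split_pow_odd_order] only reaches positive even exponents. *)
      * replace (m - (2 * p + 1) + 1) with ((2 * mu + 1) * p + mu + 1) by nia.
        replace ((2 * mu + 3) * (2 * p + 1) + 2 * 0)
          with (2 * (2 * mu + 3) * p + (2 * mu + 3)) by lia.
        now apply pow_odd_multiple_comm_prod.
      * replace (m - (2 * p + 1) + 1)
          with ((2 * mu + 1) * p + (mu + x + 1) + 1) by nia.
        replace ((2 * mu + 3) * (2 * p + 1) + 2 * S x)
          with (2 * (2 * mu + 3) * p + (2 * mu + 3 + (2 * x + 2))) by lia.
        eapply period_split_comm_prod; [|now apply split_pow_odd_order].
        apply period_odd; [easy|easy|lia].
Qed.

(** For even [n] divisible by [N], periods alone fill the power. For any other even [n], the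
    quotients of [n] and [n - 1] by [N] agree, and splitting off one commutator reduces to the odd
    case. *)
Lemma comm_pow_upper N n : 2 <= N -> a ** N = gone -> 0 < n ->
  comm_prod (n / 2 - n / N + 1) (comm a t ** n).
Proof.
  intros HN Ha Hn; rewrite commE.
  destruct (Nat.Even_or_Odd n) as [[m Hm]|[m Hm]].
  2: { replace (n / 2) with m; [subst n; now apply comm_pow_odd_upper|].
       apply (Nat.div_unique n 2 m 1); lia. }
  assert (HA : A ** N = gone) by (subst A; now rewrite pow_inv, Ha, inv_one).
  assert (Hc : c ** N = gone) by (rewrite pow_c, HA; now gsimp).
  replace (n / 2) with m by (apply (Nat.div_unique n 2 m 0); lia).
  assert (Hd := Nat.div_mod n N ltac:(lia)).
  assert (Hr := Nat.mod_upper_bound n N ltac:(lia)).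
  destruct (n mod N) as [|r] eqn:Er.
  - revert Hd; generalize (n / N); intros q Hd.
    destruct (Nat.Even_or_Odd N) as [[nu Hnu]|[nu Hnu]].
    + rewrite Hnu in *.
      assert (H := period_mul _ _ _ _ _ _ q (period_even A c nu 0 HA Hc ltac:(lia))).
      apply period_comm_prod in H; rewrite Hd.
      replace (2 * nu * q + 0) with (2 * nu * q)%nat by lia.
      now replace (m - q + 1) with ((nu - 1) * q + 1) by nia.
    + assert (exists mu, N = 2 * mu + 3) as [mu Hmu] by (exists (nu - 1); lia).
      clear nu Hnu; rewrite Hmu in *.
      destruct (Nat.Even_or_Odd q) as [[p Hp]|[p Hp]]; [|exfalso; nia].
      assert (H := period_mul _ _ _ _ _ _ p (period_odd A c mu 1 HA Hc ltac:(lia))).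
      apply period_comm_prod in H; rewrite Hd, Hp.
      replace ((2 * mu + 3) * (2 * p) + 0) with (2 * (2 * mu + 3) * p)%nat by lia.
      now replace (m - 2 * p + 1) with ((2 * mu + 1) * p + 1) by nia.
  - assert (Eq : (2 * (m - 1) + 1) / N = n / N).
    { symmetry; apply (Nat.div_unique _ N _ r); lia. }
    assert (H := comm_pow_odd_upper N (m - 1) HN Ha); rewrite Eq in H.
    assert (n / N <= m - 1) by nia.
    replace (m - n / N + 1) with (1 + (m - 1 - n / N + 1)) by lia.
    replace n with (1 + (2 * (m - 1) + 1)) at 2 by lia.
    rewrite pow_add, pow_1; apply comm_prod_mul; [rewrite <- commE; apply comm_prod1 | easy].
Qed.

Lemma comm_pow_upper_inf n : 0 < n -> comm_prod (n / 2 + 1) (comm a t ** n).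
Proof.
  intros Hn; rewrite commE.
  assert (H : forall m, comm_prod (m + 1) ((A * c) ** (2 * m + 1))).
  { intros m; apply (eq_mod_comm_prod _ _ _ _ (split_pow_odd A c m)), split_pow_comm_prod. }
  destruct (Nat.Even_or_Odd n) as [[m Hm]|[m Hm]].
  - replace (n / 2) with m by (apply (Nat.div_unique n 2 m 0); lia).
    replace (m + 1) with (1 + (m - 1 + 1)) by lia.
    replace n with (1 + (2 * (m - 1) + 1)) by lia.
    rewrite pow_add, pow_1; apply comm_prod_mul; [rewrite <- commE; apply comm_prod1 | easy].
  - replace (n / 2) with m by (apply (Nat.div_unique n 2 m 1); lia).
    now subst n.
Qed.

End UpperBound.

Close Scope grp_scope.

Module LowerBound.

Import all_boot fingroup perm boolp zify.
Import Pilot.Defs.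
Set Implicit Arguments.
Unset Strict Implicit.
Unset Printing Implicit Defensive.

(** * Orbits with trivial label product *)

Section GoodOrbits.
Variables (Gam : group) (I : finType).
Implicit Types (s : {perm I}) (lab : I -> Gam) (x y z : I) (C : {set I}).

(* Triviality of the product of the labels along an orbit, stated through a
   potential so that no base point has to be chosen. *)
Definition good s lab C : bool :=
  `[< exists h : I -> Gam, forall i, i \in C -> h (s i) = gmul (h i) (lab i) >].

Definition good_orbits s lab : {set {set I}} := [set C in porbits s | good s lab C].

Definition ngood s lab := #|good_orbits s lab|.

Lemma porbit_step s x i : i \in porbit s x -> s i \in porbit s x.
Proof.
move=> xi; have: porbit s i = porbit s x by apply/eqP; rewrite eq_porbit_mem.
by move<-; rewrite -[s i]/((s ^+ 1)%g i) mem_porbit.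
Qed.

Lemma porbit_ind s x (P : I -> Prop) : P x -> (forall i, P i -> P (s i)) ->
  forall i, i \in porbit s x -> P i.
Proof.
move=> Px Ps i /porbitP[k ->]; elim: k => [|k IH]; first by rewrite perm1.
by rewrite expgSr permM; apply: Ps.
Qed.

Lemma porbits_agree s s' C : C \in porbits s -> {in C, s =1 s'} -> C \in porbits s'.
Proof.
case/imsetP=> z _ -> eq_ss'; apply/imsetP; exists z => //.
have eqX k : (s ^+ k)%g z = (s' ^+ k)%g z.
  elim: k => [|k IH]; first by rewrite !perm1.
  by rewrite !expgSr !permM -IH eq_ss' ?mem_porbit.
by apply/setP => i; apply/porbitP/porbitP => -[k ->]; exists k.
Qed.

Lemma good_orbits_agree s s' lab C :
  C \in good_orbits s lab -> {in C, s =1 s'} -> C \in good_orbits s' lab.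
Proof.
rewrite !inE => /andP[Cs /asboolP[h hP]] eq_ss'; rewrite (porbits_agree Cs) //=.
by apply/asboolP; exists h => i iC; rewrite -eq_ss' // hP.
Qed.

Lemma porbits_mem s C x : C \in porbits s -> x \in C -> C = porbit s x.
Proof. by case/imsetP=> z _ -> xC; apply/eqP; rewrite eq_sym eq_porbit_mem. Qed.

Lemma good_orbits_tperm s lab x y C : C \in good_orbits s lab ->
  C != porbit s x -> C != porbit s y ->
  [/\ C \in good_orbits (tperm x y * s)%g lab, x \notin C & y \notin C].
Proof.
move=> gC Cx Cy; have Cs : C \in porbits s by move: gC; rewrite inE => /andP[].
have xC : x \notin C by apply: contra Cx => /(porbits_mem Cs) ->.
have yC : y \notin C by apply: contra Cy => /(porbits_mem Cs) ->.
split=> //; apply: good_orbits_agree gC _ => i iC; rewrite permM.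
by rewrite tpermD //; [apply: contraNneq xC | apply: contraNneq yC] => ->.
Qed.

(** A potential on one orbit may be multiplied on the left by a constant; this freedom makes the two
    potentials fit along both redirected arrows. *)
Lemma good_orbits_merge s lab x y : porbit s x != porbit s y ->
  porbit s x \in good_orbits s lab -> porbit s y \in good_orbits s lab ->
  porbit (tperm x y * s)%g x \in good_orbits (tperm x y * s)%g lab.
Proof.
move=> nxy; rewrite !inE => /andP[_ /asboolP[hx hxP]] /andP[_ /asboolP[hy hyP]].
rewrite /porbits imset_f //=; apply/asboolP.
pose c := gmul (gmul (hx x) (lab x)) (ginv (gmul (hy y) (lab y))).
pose Cx := porbit s x.
exists (fun i => if i \in Cx then hx i else gmul c (hy i)) => i iC.
have xCx : x \in Cx by apply: porbit_id.
have disj j : j \in porbit s y -> j \in Cx = false.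
  move=> jy; apply: contraNF nxy => jx; apply/eqP.
  by apply: etrans (_ : porbit s j = _); [symmetry|]; apply/eqP; rewrite eq_porbit_mem.
have yy : y \in porbit s y by apply: porbit_id.
have : (i \in Cx) || (i \in porbit s y).
  move: i iC; apply: porbit_ind => [|j]; first by rewrite xCx.
  rewrite permM; case: tpermP => [->|->|_ _].
  - by rewrite (porbit_step yy) orbT.
  - by rewrite (porbit_step xCx).
  - by case/orP => /porbit_step ->; rewrite ?orbT.
rewrite permM; case: tpermP => [->|->|nix niy].
- by rewrite xCx (disj _ (porbit_step yy)) hyP // /c; gsimp.
- by rewrite (disj _ yy) (porbit_step xCx) hxP // /c; gsimp.
- case/orP=> iC'; first by rewrite iC' (porbit_step iC') hxP.
  by rewrite (disj _ iC') (disj _ (porbit_step iC')) hyP //; gsimp.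
Qed.

Lemma setD1_notin (g : {set {set I}}) C : C \notin g -> g :\ C = g.
Proof. by move=> Cg; apply/setDidPl; rewrite disjoint_sym disjoints1. Qed.

(** Only the orbits of [x] and [y] are affected. If both are good and distinct, they merge into a
    good one; otherwise at most one good orbit was there to lose. *)
Lemma ngood_tperml s lab x y : ngood s lab <= ngood (tperm x y * s)%g lab + 1.
Proof.
rewrite /ngood; set g := good_orbits s lab; set g' := good_orbits _ lab.
set Cx := porbit s x; set Cy := porbit s y.
have sub : g :\ Cx :\ Cy \subset g'.
  apply/subsetP => C; rewrite !in_setD1 => /and3P[Cy' Cx' gC].
  by case: (good_orbits_tperm gC Cx' Cy').
have [Cxg|Cxg] := boolP (Cx \in g); last first.
  rewrite (cardsD1 Cy) addnC leq_add ?leq_b1 //; apply: subset_leq_card.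
  by rewrite (setD1_notin Cxg) in sub.
have [Cyg|Cyg] := boolP (Cy \in g); last first.
  rewrite (cardsD1 Cx) addnC leq_add ?leq_b1 //; apply: subset_leq_card.
  by rewrite setD1_notin ?in_setD1 ?negb_and ?Cyg ?orbT in sub.
have [eqxy|nxy] := eqVneq Cx Cy.
  rewrite (cardsD1 Cx) addnC leq_add ?leq_b1 //; apply: subset_leq_card.
  by apply: subset_trans sub; rewrite -eqxy setDDl setUid.
have mg := good_orbits_merge nxy Cxg Cyg.
rewrite (cardsD1 Cx) Cxg (cardsD1 Cy) in_setD1 eq_sym nxy Cyg /= addnC leq_add2r.
rewrite -/g' in mg; rewrite (cardsD1 (porbit (tperm x y * s)%g x) g') mg leq_add2l.
apply: subset_leq_card; apply/subsetP => C Cg; rewrite in_setD1 (subsetP sub) // andbT.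
move: Cg; rewrite !in_setD1 => /and3P[Cy' Cx' gC].
case: (good_orbits_tperm gC Cx' Cy') => _ xC _.
by apply: contraNneq xC => ->; apply: porbit_id.
Qed.

Lemma tpermr_conj s x y : (s * tperm x y = tperm (s^-1 x) (s^-1 y) * s)%g.
Proof. by apply/permP => i; rewrite !permM (inj_tperm _ _ _ (@perm_inj _ s)) !permKV. Qed.

Lemma ngood_tpermr s lab x y : ngood s lab <= ngood (s * tperm x y)%g lab + 1.
Proof. by rewrite tpermr_conj ngood_tperml. Qed.

(* An element with trivial label can be cut out of its orbit without spoiling it. *)
Lemma ngood_cut s lab x : s x != x -> lab x = gone ->
  ngood s lab + 1 <= ngood (s * tperm x (s x))%g lab.
Proof.
move=> sx lx; set s' := (s * _)%g; set C := porbit s x.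
have s'E i : s' i = if i == x then x else if s i == x then s x else s i.
  rewrite permM; have [->|nix] := eqVneq i x; first by rewrite tpermR.
  have [->|nsi] := eqVneq (s i) x; first by rewrite tpermL.
  by rewrite tpermD // eq_sym // (inj_eq perm_inj).
have Cx : porbit s' x = [set x].
  apply/setP => i; rewrite inE; apply/idP/eqP => [|->]; last exact: porbit_id.
  by move: i; apply: porbit_ind => // j ->; rewrite s'E eqxx.
have gx : [set x] \in good_orbits s' lab.
  rewrite inE -{1}Cx imset_f //=; apply/asboolP; exists (fun=> gone) => i.
  by rewrite inE => /eqP ->; rewrite lx gmul1r.
have xC : x \in C by apply: porbit_id.
have sub : good_orbits s lab :\ C \subset good_orbits s' lab :\ [set x].
  apply/subsetP => D; rewrite !in_setD1 => /andP[DC gD].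
  have Ds : D \in porbits s by move: gD; rewrite inE => /andP[].
  have xD : x \notin D by apply: contra DC => /(porbits_mem Ds) ->.
  apply/andP; split; first by apply: contraNneq xD => ->; rewrite inE.
  apply: good_orbits_agree gD _ => i iD; rewrite s'E.
  case: eqP iD xD => [-> ->//|_ iD xD]; case: eqP => // six.
  case/negP: xD; rewrite -six; case/imsetP: Ds iD => z _ ->; exact: porbit_step.
rewrite /ngood (cardsD1 [set x] (good_orbits s' lab)) gx addnC leq_add2l.
have [Cg|Cg] := boolP (C \in good_orbits s lab); last first.
  by apply: subset_leq_card; rewrite (setD1_notin Cg) in sub.
pose D := porbit s' (s x).
have DC : {subset D <= C}.
  apply: porbit_ind => [|j jC]; first exact: porbit_step.
  by rewrite s'E; case: ifP => // _; case: ifP => _; apply: porbit_step.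
have gD : D \in good_orbits s' lab.
  rewrite inE imset_f //=; move: Cg; rewrite inE => /andP[_ /asboolP[h hP]].
  apply/asboolP; exists h => i /DC iC; rewrite s'E; have [->|_] := eqVneq i x.
    by rewrite lx gmul1r.
  case: eqP => [six|_]; last exact: hP.
  by rewrite -(hP i iC) six (hP x xC) lx gmul1r.
rewrite (cardsD1 C (good_orbits s lab)) Cg (cardsD1 D (_ :\ [set x])) in_setD1 gD andbT.
have sxD : s x \in D by apply: porbit_id.
have -> : D != [set x] by apply: contraNneq sx => DE; rewrite DE inE in sxD.
rewrite leq_add2l; apply: subset_leq_card; apply/subsetP => E Eg.
rewrite in_setD1 (subsetP sub) // andbT.
move: Eg; rewrite in_setD1 => /andP[EC]; rewrite inE => /andP[Es _].
apply: contraNneq EC => ED; rewrite ED in Es *.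
by rewrite (porbits_mem Es sxD) eq_porbit_mem porbit_step.
Qed.

(** A factor of the label moves from [x] to its successor [y]; correcting the potential at [y] alone
    compensates for this. *)
Lemma ngood_slide s lab lab' x y : s x = y -> x != y ->
  (forall i, i != x -> i != y -> lab i = lab' i) ->
  gmul (lab x) (lab y) = gmul (lab' x) (lab' y) -> ngood s lab <= ngood s lab'.
Proof.
move=> sxy nxy eql eqxy; apply: subset_leq_card; apply/subsetP => C.
rewrite !inE => /andP[-> /asboolP[h hP]] /=; apply/asboolP.
pose g := gmul (ginv (lab x)) (lab' x).
exists (fun i => if i == y then gmul (h i) g else h i) => i iC.
have siy : (s i == y) = (i == x) by rewrite -sxy (inj_eq perm_inj).
rewrite siy; have [ix|nix] := eqVneq i x.
  by rewrite ix (negPf nxy) -ix hP // ix /g; gsimp.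
rewrite hP //; have [iy|niy] := eqVneq i y; last by rewrite eql.
rewrite iy /g -!gmulA; congr gmul.
by apply: (@mul_cancel_l _ (lab x)); rewrite eqxy; gsimp.
Qed.
End GoodOrbits.

(** * Cyclic successors under insertion of a letter and exchange of blocks *)

Section Next.
Variable T : eqType.
Implicit Types (x y z : T) (p q r e : seq T).

Lemma next_succ p x y q : uniq (p ++ x :: y :: q) -> next (p ++ x :: y :: q) x = y.
Proof.
by move=> Ue; rewrite -(next_rot (size p) Ue) rot_size_cat /= eqxx.
Qed.

Lemma next_last p x y : uniq (y :: rcons p x) -> next (y :: rcons p x) x = y.
Proof.
move=> Ue; rewrite -(next_rot (size (y :: p)) Ue) -rcons_cons -cats1.
by rewrite rot_size_cat /= eqxx.
Qed.

Lemma next_inner p x z : z \in p -> exists y, forall u v,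
  uniq (u ++ rcons p x ++ v) -> next (u ++ rcons p x ++ v) z = y.
Proof.
case/splitPr=> p1 p2; exists (head x p2) => u v.
by rewrite rcons_cat rcons_cons headI /= -catA catA /= => Ue; rewrite next_succ.
Qed.

Lemma next_junction u v p q x y : uniq (u ++ rcons p x ++ rcons q y ++ v) ->
  next (u ++ rcons p x ++ rcons q y ++ v) x = head y q.
Proof. by rewrite -cats1 -catA catA (headI q) /= => Ue; rewrite next_succ. Qed.

Lemma next_wrap u p q x y : uniq (rcons p x ++ u ++ rcons q y) ->
  next (rcons p x ++ u ++ rcons q y) y = head x p.
Proof. by rewrite (headI p) cat_cons -!rcons_cat => Ue; rewrite next_last. Qed.

End Next.

Section NextPerm.
Variable I : finType.
Implicit Types (i j x y : I) (v e p q r : seq I).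

(** Inserting an index changes the cyclic shift by one transposition. In the factorisation
    [al \o be] it can be placed on the left, to be absorbed by [al], or, as in [next_cons2r], on the
    right, to be absorbed by [be]. *)
Lemma next_cons2l x y v j : uniq [:: x, y & v] ->
  next [:: x, y & v] j = tperm x y (next (y :: v) j).
Proof.
rewrite /= inE negb_or -andbA => /and4P[nxy xv yv Uv].
have [->|njx] := eqVneq j x.
  suff -> : forall z, z != x -> next_at x y z v = x by rewrite ?tpermL // eq_sym.
  elim: v xv {yv Uv} => /= [|z v IH] xv u ux; rewrite eq_sym (negPf ux) //.
  by move: xv; rewrite inE negb_or => /andP[xz xv]; rewrite IH // eq_sym.
have [jy|njy] := eqVneq j y.
  rewrite jy; case: v xv yv {Uv} => [|u v] /=; rewrite eqxx ?tpermR //.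
  by rewrite !inE !negb_or => /andP[? _] /andP[? _]; rewrite tpermD.
suff H z : next_at j x z v = tperm x y (next_at j y z v) by exact: H.
elim: v z xv yv {Uv} => [|u v IH] z /= xv yv.
  by case: eqP => _; [rewrite tpermR | rewrite tpermD // eq_sym].
move: xv yv; rewrite !inE !negb_or => /andP[xu xv] /andP[yu yv].
by case: eqP => _; [rewrite tpermD | exact: IH].
Qed.

Lemma next_cons2r x y v j : uniq [:: x, y & v] ->
  next [:: x, y & v] j = next (x :: v) (tperm x y j).
Proof.
rewrite /= inE negb_or -andbA => /and4P[nxy xv yv Uv].
have notin u z : y \notin u -> y != z -> next_at y x z u = y.
  elim: u z => [|w u IH] z /=; first by case: eqP.
  by rewrite inE negb_or => /andP[yw yu] /negPf ->; apply: IH.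
case: tpermP => [->|->|njx njy].
- by rewrite eqxx notin // eq_sym.
- by rewrite (eq_sym y) (negPf nxy); case: v {notin xv yv Uv} => [|u v] /=; rewrite !eqxx.
- move/eqP/negPf: njx => njx; move/eqP/negPf: njy => njy.
  by rewrite njx; case: v {notin xv yv Uv} => [|u v] /=; rewrite ?njx ?njy.
Qed.

(** Only the last index of each block gets a new successor, so the two cyclic shifts differ by a
    3-cycle, that is, by two transpositions. *)
Lemma next_block_swap p q r lp lq lr j :
  let e := rcons p lp ++ rcons q lq ++ rcons r lr in uniq e ->
  next (rcons q lq ++ rcons p lp ++ rcons r lr) j =
    next e ((tperm lp lq * tperm lp lr)%g j).
Proof.
set P := rcons p lp; set Q := rcons q lq; set R := rcons r lr => e Ue.
have pe : perm_eq e (Q ++ P ++ R) by rewrite /e perm_catCA.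
have Ue' : uniq (Q ++ P ++ R) by rewrite -(perm_uniq pe).
have lastP' (s : seq I) l : l \in rcons s l by rewrite mem_rcons mem_head.
have [PQ PR QR] : [/\ lp != lq, lp != lr & lq != lr].
  move: Ue; rewrite /e !cat_uniq => /and3P[_ dP /and3P[_ dQ _]]; split.
  - by apply: contraNneq dP => pq; apply/hasP; exists lq; rewrite ?mem_cat ?lastP' // -pq lastP'.
  - apply: contraNneq dP => pq; apply/hasP; exists lr; last by rewrite /= -pq lastP'.
    by rewrite mem_cat lastP' orbT.
  - by apply: contraNneq dQ => pq; apply/hasP; exists lr; rewrite ?lastP' // -pq lastP'.
rewrite permM; have [->|jp] := eqVneq j lp.
  rewrite tpermL (tpermD PQ) 1?eq_sym //.
  rewrite -[Q ++ P ++ R]/(Q ++ rcons p lp ++ R) -(cats0 R) next_junction ?cats0 //.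
  by rewrite /e -(cats0 R) next_junction ?cats0.
have [->|jq] := eqVneq j lq.
  rewrite tpermR tpermL next_wrap //.
  by rewrite -[Q ++ P ++ R]/([::] ++ Q ++ P ++ R) next_junction.
have [->|jr] := eqVneq j lr.
  rewrite (tpermD PR QR) tpermR next_wrap //.
  by rewrite /e -[P ++ Q ++ R]/([::] ++ P ++ Q ++ R) next_junction.
rewrite !tpermD 1?[_ == j]eq_sym //.
have [je|jne] := boolP (j \in e); last first.
  by rewrite !next_nth -(perm_mem pe) (negPf jne).
move: je; rewrite /e !mem_cat !mem_rcons !inE (negPf jp) (negPf jq) (negPf jr) /=.
case/or3P => /next_inner.
- by case/(_ lp) => y yP; rewrite (yP Q R) // (yP [::] (Q ++ R)).
- by case/(_ lq) => y yP; rewrite (yP [::] (P ++ R)) // (yP P R).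
- by case/(_ lr) => y yP; move: (yP (Q ++ P) [::]) (yP (P ++ Q) [::]);
    rewrite !cats0 -!catA => -> // ->.
Qed.

End NextPerm.

(** * Diagrams *)

Section Diagrams.
Variables A B : group.
Implicit Types (W u v : seq (A * B)) (k : nat).

(* [e] lists the indices of the word in cyclic order; an index outside [e] is a
   fixed point with trivial labels and accounts for two good orbits. *)
Definition is_diagram (I : finType) (e : seq I) (la : I -> A) (lb : I -> B)
    (al be : {perm I}) k : Prop :=
  [/\ uniq e,
      forall i, i \notin e -> [/\ al i = i, la i = gone & lb i = gone],
      forall i, al (be i) = next e i &
      #|I| + #|I| + 1 <= size e + ngood al la + ngood be lb + k.*2].

(* The [N] spare indices make room for inserting letters. *)
Definition has_diagram W k : Prop := forall N : nat,
  exists (I : finType) (e : seq I) (la : I -> A) (lb : I -> B) (al be : {perm I}),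
    [/\ is_diagram e la lb al be k,
        [seq (la i, lb i) | i <- e] = W & size e + N <= #|I|].

Lemma next_notin (I : eqType) (e : seq I) i : i \notin e -> next e i = i.
Proof. by move=> ie; rewrite next_nth (negPf ie). Qed.

Lemma be_notin I e la lb (al be : {perm I}) k i :
  is_diagram e la lb al be k -> i \notin e -> be i = i.
Proof.
case=> _ fix_e nextE _ ie; apply: (@perm_inj _ al).
by rewrite nextE next_notin //; case: (fix_e _ ie).
Qed.

Lemma be_in I e la lb (al be : {perm I}) k i :
  is_diagram e la lb al be k -> (be i \in e) = (i \in e).
Proof.
move=> D; apply/idP/idP => ie; apply: contraLR ie => ie.
  by rewrite (be_notin D).
by have := be_notin D ie => /perm_inj <-.
Qed.

Lemma has_diagram_le W k l : k <= l -> has_diagram W k -> has_diagram W l.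
Proof.
move=> kl H N; case: (H N) => I [e [la [lb [al [be [[Ue fe ne ce] eW sI]]]]]].
exists I, e, la, lb, al, be; split=> //; split=> //.
by apply: leq_trans ce _; rewrite leq_add2l leq_double.
Qed.

Lemma has_diagram_rot u v k : has_diagram (u ++ v) k -> has_diagram (v ++ u) k.
Proof.
move=> H N; case: (H N) => I [e [la [lb [al [be [[Ue fe ne ce] eW sI]]]]]].
exists I, (rot (size u) e), la, lb, al, be; split; last 1 first.
- by rewrite size_rot.
- split; first by rewrite rot_uniq.
  + by move=> i; rewrite mem_rot; apply: fe.
  + by move=> i; rewrite ne next_rot.
  + by rewrite size_rot.
- by rewrite map_rot eW rot_size_cat.
Qed.

Lemma ngood1 (Gam : group) (I : finType) : ngood 1%g (fun _ : I => gone : Gam) = #|I|.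
Proof.
rewrite /ngood.
have -> : good_orbits 1%g (fun _ : I => gone : Gam) = porbits 1%g.
  apply/setP => C; rewrite inE andb_idr // => _; apply/asboolP.
  by exists (fun=> gone) => i _; rewrite gmul1r.
rewrite card_imset // => x y /eqP; rewrite eq_porbit_mem => /porbitP[i ->].
by rewrite expg1n perm1.
Qed.

(** The disc: every orbit is a good singleton, and the Euler characteristic inequality is an
    equality. *)
Lemma has_diagram1 : has_diagram [:: (gone, gone)] 0.
Proof.
move=> N; exists 'I_N.+1, [:: ord0], (fun=> gone), (fun=> gone), 1%g, 1%g.
rewrite /is_diagram !ngood1 !card_ord; split=> //.
split=> // [i _|i|]; last by rewrite /=; lia.
- by rewrite perm1.
- by rewrite !perm1 /=; case: eqP.
Qed.

Lemma map_cons_inv (S T : Type) (f : S -> T) e w (V : seq T) : map f e = w :: V ->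
  exists i e', [/\ e = i :: e', f i = w & map f e' = V].
Proof. by case: e => //= i e' [<- <-]; exists i, e'. Qed.

Definition relabel (I : finType) (T : Type) (f : I -> T) (i : I) (x : T) : I -> T :=
  fun j => if j == i then x else f j.

Lemma relabel_map (I : finType) (la la' : I -> A) (lb lb' : I -> B) (e : seq I) :
  {in e, la =1 la'} -> {in e, lb =1 lb'} ->
  [seq (la i, lb i) | i <- e] = [seq (la' i, lb' i) | i <- e].
Proof. by move=> Ha Hb; apply/eq_in_map => i iv; rewrite Ha ?Hb. Qed.

Lemma exists_notin (I : finType) (e : seq I) : uniq e -> size e < #|I| ->
  exists i, i \notin e.
Proof.
move=> Ue lt_e; apply/existsP; rewrite -negb_forall; apply: contraL lt_e.
by move/forallP => ee; rewrite -leqNgt -(card_uniqP Ue) subset_leq_card //; apply/subsetP.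
Qed.

(** A spare index is joined to the [al]-orbit of [y]. The good orbit that this may lose is paid for
    by the growth of [size e]; afterwards [ngood_slide] distributes the label. *)
Lemma has_diagram_insertl (a1 a2 : A) (b : B) v k :
  has_diagram ((gmul a1 a2, b) :: v) k -> has_diagram [:: (a1, gone), (a2, b) & v] k.
Proof.
move=> H N; case: (H N.+1) => I [e [la [lb [al [be [D eW sI]]]]]].
have [y [p [Ee [lay lby] pv]]] := map_cons_inv eW; subst e.
have Dbe := be_notin D; case: D => Ue fe ne ce.
have [x xe] : exists x, x \notin y :: p by apply: exists_notin => //; lia.
have nxy : x != y by apply: contraNneq xe => ->; apply: mem_head.
have nyp : y \notin p by case/andP: Ue.
have xp : x \notin p by apply: contra xe => xp; rewrite inE xp orbT.
have U' : uniq [:: x, y & p] by rewrite cons_uniq xe.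
have [alx lax lbx] := fe _ xe.
pose la' := relabel (relabel la x a1) y a2.
exists I, [:: x, y & p], la', lb, (al * tperm x y)%g, be; split; last 1 first.
- by move: sI => /=; lia.
- split=> //.
  + move=> i; rewrite !inE !negb_or => /and3P[ix iy ip].
    have [ali lai lbi] : [/\ al i = i, la i = gone & lb i = gone].
      by apply: fe; rewrite inE negb_or iy.
    by rewrite permM ali tpermD 1?eq_sym // /la' /relabel (negPf ix) (negPf iy).
  + by move=> i; rewrite permM ne next_cons2l.
  + have := ngood_tpermr al la x y.
    have sxy : (al * tperm x y)%g x = y by rewrite permM alx tpermL.
    have : ngood (al * tperm x y)%g la <= ngood (al * tperm x y)%g la'.
      apply: (ngood_slide sxy) => // [i ix iy|].
        by rewrite /la' /relabel (negPf ix) (negPf iy).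
      by rewrite /la' /relabel !eqxx (negPf nxy) lax lay gmul1l.
    by move: ce => /=; lia.
- rewrite /= /la' /relabel !eqxx (negPf nxy) lbx lby -pv; congr [:: _, _ & _].
  apply: relabel_map => // i ip /=.
  by rewrite !ifN //; [apply: contraNneq xp | apply: contraNneq nyp] => <-.
Qed.

Lemma has_diagram_insertr (a : A) (b1 b2 : B) v k :
  has_diagram ((a, gmul b1 b2) :: v) k -> has_diagram [:: (a, b1), (gone, b2) & v] k.
Proof.
move=> H N; case: (H N.+1) => I [e [la [lb [al [be [D eW sI]]]]]].
have [x [p [Ee [lax lbx] pv]]] := map_cons_inv eW; subst e.
have Dbe := be_notin D; case: D => Ue fe ne ce.
have [y ye] : exists y, y \notin x :: p by apply: exists_notin => //; lia.
have nxy : x != y by apply: contraNneq ye => <-; apply: mem_head.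
have nxp : x \notin p by case/andP: Ue.
have yp : y \notin p by apply: contra ye => yp; rewrite inE yp orbT.
have U' : uniq [:: x, y & p].
  by rewrite /= inE negb_or nxy nxp yp; case/andP: Ue.
have [aly lay lby] := fe _ ye.
pose lb' := relabel (relabel lb x b1) y b2.
exists I, [:: x, y & p], la, lb', al, (tperm x y * be)%g; split; last 1 first.
- by move: sI => /=; lia.
- split=> //.
  + move=> i; rewrite !inE !negb_or => /and3P[ix iy ip].
    have [ali lai lbi] : [/\ al i = i, la i = gone & lb i = gone].
      by apply: fe; rewrite inE negb_or ix.
    by rewrite ali /lb' /relabel (negPf ix) (negPf iy).
  + by move=> i; rewrite permM ne next_cons2r.
  + have := ngood_tperml be lb x y.
    have sxy : (tperm x y * be)%g x = y by rewrite permM tpermL Dbe.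
    have : ngood (tperm x y * be)%g lb <= ngood (tperm x y * be)%g lb'.
      apply: (ngood_slide sxy) => // [i ix iy|].
        by rewrite /lb' /relabel (negPf ix) (negPf iy).
      by rewrite /lb' /relabel !eqxx (negPf nxy) lbx lby gmul1r.
    by move: ce => /=; lia.
- rewrite /= /lb' /relabel !eqxx (negPf nxy) lay lax -pv; congr [:: _, _ & _].
  apply: relabel_map => // i ip /=.
  by rewrite !ifN //; [apply: contraNneq nxp | apply: contraNneq yp] => <-.
Qed.

(* Cutting the index of the trivial letter out of its orbit gains the orbit that
   the compensating transposition on the other side may lose. *)
Lemma has_diagram_deletel (a1 a2 : A) (b : B) v k :
  has_diagram [:: (a1, gone), (a2, b) & v] k -> has_diagram ((gmul a1 a2, b) :: v) k.
Proof.
move=> H N; case: (H N) => I [e [la [lb [al [be [D eW sI]]]]]].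
have [x [p [Ee [lax lbx] ep]]] := map_cons_inv eW.
have [y [q [Ep [lay lby] pv]]] := map_cons_inv ep.
subst e p; have Dbe i := be_in i D; case: D => Ue fe ne ce.
have /and4P[nxy xq yq Uq] : [&& x != y, x \notin q, y \notin q & uniq q].
  by move: Ue; rewrite /= inE negb_or -!andbA.
pose z := be x.
have ze : z \in [:: x, y & q] by rewrite Dbe mem_head.
pose al1 := (tperm x z * al)%g; pose be1 := (be * tperm x z)%g.
have be1x : be1 x = x by rewrite permM tpermR.
have ab1 i : al1 (be1 i) = next [:: x, y & q] i by rewrite !permM tpermK ne.
have al1x : al1 x = y by rewrite -[in al1 x]be1x ab1 /= eqxx.
have ce1 : ngood al la + ngood be lb <= ngood al1 la + ngood be1 lb.
  have := ngood_tperml al la x z; rewrite -/al1.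
  have [zx|zx] := eqVneq z x.
    by rewrite /al1 /be1 zx tperm1 mul1g mulg1.
  by have := ngood_cut zx lbx; rewrite -/z -/be1; lia.
pose la' := relabel (relabel la x gone) y (gmul a1 a2).
(* Sliding the whole [A]-letter of [x] into [y] makes [x] removable from its [al1]-orbit too; that
   second cut pays for the loss in [size e]. *)
have ce2 : ngood al1 la <= ngood al1 la'.
  apply: (ngood_slide al1x) => // [i ix iy|].
    by rewrite /la' /relabel (negPf ix) (negPf iy).
  by rewrite /la' /relabel !eqxx (negPf nxy) lax lay gmul1l.
have ce3 : ngood al1 la' + 1 <= ngood (al1 * tperm x y)%g la'.
  rewrite -[y in tperm x y]al1x; apply: ngood_cut; first by rewrite al1x eq_sym.
  by rewrite /la' /relabel (negPf nxy) eqxx.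
exists I, (y :: q), la', lb, (al1 * tperm x y)%g, be1; split; last 1 first.
- by move: sI => /=; lia.
- split=> //.
  + by case/andP: Ue.
  + move=> i; rewrite inE negb_or => /andP[iy iq].
    have [->|ix] := eqVneq i x.
      by rewrite permM al1x tpermR /la' /relabel (negPf nxy) eqxx.
    have ie : i \notin [:: x, y & q] by rewrite !inE !negb_or ix iy.
    have [ali lai lbi] := fe _ ie.
    have zi : z != i by apply: contraNneq ie => <-.
    have xzi : tperm x z i = i by rewrite tpermD // eq_sym.
    rewrite /la' /relabel (negPf ix) (negPf iy) lai lbi !permM xzi ali.
    by rewrite tpermD // eq_sym.
  + by move=> i; rewrite permM ab1 next_cons2l // tpermK.
  + by move: ce => /=; lia.
- rewrite /= /la' /relabel !eqxx lby -pv; congr (_ :: _).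
  apply: relabel_map => // i iq /=.
  by rewrite !ifN //; [apply: contraNneq xq | apply: contraNneq yq] => <-.
Qed.

(** Mirror image of [has_diagram_deletel]: [y], whose [A]-letter is trivial, is first cut out of its
    [al]-orbit, and its [B]-letter is then slid back into [x]. *)
Lemma has_diagram_deleter (a : A) (b1 b2 : B) v k :
  has_diagram [:: (a, b1), (gone, b2) & v] k -> has_diagram ((a, gmul b1 b2) :: v) k.
Proof.
move=> H N; case: (H N) => I [e [la [lb [al [be [D eW sI]]]]]].
have [x [p [Ee [lax lbx] ep]]] := map_cons_inv eW.
have [y [q [Ep [lay lby] pv]]] := map_cons_inv ep.
subst e p; have Dbe i := be_in i D; case: D => Ue fe ne ce.
have /and4P[nxy xq yq Uq] : [&& x != y, x \notin q, y \notin q & uniq q].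
  by move: Ue; rewrite /= inE negb_or -!andbA.
pose z := (al^-1)%g y.
have ze : z \in [:: x, y & q].
  apply: contraT => ze; have [alz _ _] := fe _ ze.
  by move: ze; rewrite -alz permKV !inE eqxx orbT.
pose al1 := (tperm y z * al)%g; pose be1 := (be * tperm y z)%g.
have al1y : al1 y = y by rewrite permM tpermL permKV.
have ab1 i : al1 (be1 i) = next [:: x, y & q] i by rewrite !permM tpermK ne.
have be1x : be1 x = y by apply: (@perm_inj _ al1); rewrite ab1 /= eqxx al1y.
have ce1 : ngood al la + ngood be lb <= ngood al1 la + ngood be1 lb.
  have := ngood_tpermr be lb y z; rewrite -/be1.
  have [zy|zy] := eqVneq (al y) y.
    have {}zy : z = y by rewrite /z -[in LHS]zy permK.
    by rewrite /al1 /be1 zy tperm1 mul1g mulg1.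
  by have := ngood_cut zy lay; rewrite tpermr_conj permK tpermC -/z -/al1; lia.
pose lb' := relabel (relabel lb x (gmul b1 b2)) y gone.
have ce2 : ngood be1 lb <= ngood be1 lb'.
  apply: (ngood_slide be1x) => // [i ix iy|].
    by rewrite /lb' /relabel (negPf ix) (negPf iy).
  by rewrite /lb' /relabel !eqxx (negPf nxy) lbx lby gmul1r.
have be1y : be1 y != y by rewrite -{2}be1x (inj_eq perm_inj) eq_sym.
have ce3 : ngood be1 lb' + 1 <= ngood (tperm x y * be1)%g lb'.
  have := ngood_cut be1y (_ : lb' y = gone).
  rewrite tpermr_conj permK -{2}be1x permK tpermC; apply.
  by rewrite /lb' /relabel eqxx.
exists I, (x :: q), la, lb', al1, (tperm x y * be1)%g; split; last 1 first.
- by move: sI => /=; lia.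
- split=> //.
  + by rewrite /= xq.
  + move=> i; rewrite inE negb_or => /andP[ix iq].
    have [->|iy] := eqVneq i y.
      by rewrite al1y /lb' /relabel eqxx.
    have ie : i \notin [:: x, y & q] by rewrite !inE !negb_or ix iy.
    have [ali lai lbi] := fe _ ie.
    have zi : z != i by apply: contraNneq ie => <-.
    have yzi : tperm y z i = i by rewrite tpermD // eq_sym.
    by rewrite /lb' /relabel (negPf ix) (negPf iy) lai lbi permM yzi.
  + by move=> i; rewrite permM ab1 next_cons2r // tpermK.
  + by move: ce => /=; lia.
- rewrite /= /lb' /relabel !eqxx (negPf nxy) lax -pv; congr (_ :: _).
  apply: relabel_map => // i iq /=.
  by rewrite !ifN //; [apply: contraNneq xq | apply: contraNneq yq] => <-.
Qed.

(** By [next_block_swap], two transpositions absorbed by [be] realise the exchange. They lose at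
    most two good orbits, which is what raising [k] by one allows. If a block is empty, the words
    agree or differ by a rotation. *)
Lemma has_diagram_swap u v w k :
  has_diagram (u ++ v ++ w) k -> has_diagram (v ++ u ++ w) k.+1.
Proof.
case/lastP: u => [|u x]; first by apply: has_diagram_le.
case/lastP: v => [|v y]; first by apply: has_diagram_le.
case/lastP: w => [|w z].
  by rewrite !cats0 => /has_diagram_rot; apply: has_diagram_le.
move=> H N; case: (H N) => I [e [la [lb [al [be [D eW sI]]]]]].
have Dbe i := be_in i D; case: D => Ue fe ne ce.
have split_rcons e0 (u0 : seq (A * B)) x0 v0 :
    [seq (la i, lb i) | i <- e0] = rcons u0 x0 ++ v0 ->
    exists p i q, [/\ e0 = rcons p i ++ q,
      [seq (la i, lb i) | i <- rcons p i] = rcons u0 x0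
      & [seq (la i, lb i) | i <- q] = v0].
  move=> E; set n := size (rcons u0 x0).
  have E1 : [seq (la i, lb i) | i <- take n e0] = rcons u0 x0 by rewrite map_take E take_size_cat.
  have E2 : [seq (la i, lb i) | i <- drop n e0] = v0 by rewrite map_drop E drop_size_cat.
  case/lastP: (take _ _) E1 (cat_take_drop n e0) => [|p i] E1 E3.
    by case: (u0) E1.
  by exists p, i, (drop n e0).
have [p [i [e1 [Ee Ep E1]]]] := split_rcons _ _ _ _ eW.
have [q [j [r0 [Ee1 Eq E0]]]] := split_rcons _ _ _ _ E1.
have [r [l [e2 [Er0 Er E2]]]] : exists p i q, [/\ r0 = rcons p i ++ q,
    [seq (la i, lb i) | i <- rcons p i] = rcons w z & [seq (la i, lb i) | i <- q] = [::]].
  by apply: split_rcons; rewrite cats0.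
have {}E2 : e2 = [::] by case: (e2) E2.
subst e2; rewrite cats0 in Er0; subst r0 e1 e.
have pe : perm_eq (rcons p i ++ rcons q j ++ rcons r l) (rcons q j ++ rcons p i ++ rcons r l).
  by rewrite perm_catCA.
exists I, (rcons q j ++ rcons p i ++ rcons r l), la, lb, al,
  (tperm i j * tperm i l * be)%g; split; last 1 first.
- by rewrite -(perm_size pe).
- split=> //.
  + by rewrite -(perm_uniq pe).
  + by move=> n; rewrite -(perm_mem pe); apply: fe.
  + by move=> n; rewrite permM ne; apply/esym/next_block_swap.
  + have := ngood_tperml (tperm i l * be)%g lb i j; rewrite mulgA.
    have := ngood_tperml be lb i l; rewrite -(perm_size pe) doubleS.
    move=> le1 le2; have {le1 le2}le3 := leq_trans le1 (leq_add le2 (leqnn 1)).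
    apply: leq_trans ce _; rewrite -!addnA !leq_add2l.
    by apply: leq_trans (leq_add le3 (leqnn _)) _; rewrite -!addnA leq_add2l.
- by rewrite !map_cat Ep Eq Er.
Qed.
End Diagrams.

(** * Words and normal forms in the free product of two groups *)

Section Words.
Variables A B : group.
Implicit Types (W X Y u v w x : seq (A * B)) (p q : A * B) (k : nat).

(** A letter [(a, b)] stands for the product [a b], so its inverse takes two letters. *)
Fixpoint winv W : seq (A * B) :=
  if W is p :: W' then winv W' ++ [:: (gone, ginv p.2); (ginv p.1, gone)] else [::].

Lemma winv_cat u v : winv (u ++ v) = winv v ++ winv u.
Proof. by elim: u => [|p u IH] /=; rewrite ?cats0 // IH catA. Qed.

(** The insertion lemmas split an existing letter, here the one that follows the inserted piece
    cyclically; hence the word must be nonempty. *)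
Lemma has_diagram_insert3 p u v k : u ++ v <> [::] ->
  has_diagram (u ++ v) k ->
  has_diagram (u ++ [:: (gone, ginv p.2); (ginv p.1, gone); p] ++ v) k.
Proof.
case: p => a b /= uv H; have {H} := has_diagram_rot H.
have : v ++ u <> [::] by case: (v) uv => //; rewrite cats0; case: (u).
case E : (v ++ u) => [|[c d] w] // _ H.
apply: has_diagram_rot; rewrite /= E.
apply: (@has_diagram_rot _ _ [:: (ginv a, gone), (a, b), (c, d) & w] [:: (gone, ginv b)]).
apply: has_diagram_insertl; rewrite gmulVl.
apply: (@has_diagram_rot _ _ [:: (gone, ginv b)] [:: (gone, b), (c, d) & w]).
apply: has_diagram_insertr.
by rewrite gmulVl; apply: has_diagram_insertl; rewrite gmul1l.
Qed.

Lemma has_diagram_insert_inv X u v k : u ++ v <> [::] ->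
  has_diagram (u ++ v) k -> has_diagram (u ++ winv X ++ X ++ v) k.
Proof.
elim: X u v => [|p X IH] u v uv H //=.
have := @has_diagram_insert3 p (u ++ winv X) (X ++ v) k.
rewrite -!catA /=; apply; last exact: IH.
move/(congr1 size); rewrite !size_cat; case: u {H} uv => // uv.
by case: v uv => //= ? ? _; lia.
Qed.

(** The word [winv X ++ X ++ winv Y ++ Y ++ v] is obtained at no cost, and exchanging the blocks [X]
    and [winv Y] costs one handle. *)
Lemma has_diagram_comm X Y v k : v <> [::] -> has_diagram v k ->
  has_diagram (winv X ++ winv Y ++ X ++ Y ++ v) k.+1.
Proof.
move=> v0 H; have H1 := @has_diagram_insert_inv Y [::] v k v0 H.
have H2 := @has_diagram_insert_inv X [::] _ k _ H1.
apply: has_diagram_rot; rewrite -!catA; apply: has_diagram_swap.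
rewrite 3!catA; apply: has_diagram_rot; rewrite -!catA; apply: H2.
by move/(congr1 size); rewrite /= !size_cat; case: v v0 {H H1} => //= *; lia.
Qed.

(** * Normal forms and the actions of the two factors on them *)

Definition is1 (G : group) (g : G) : bool := `[< g = gone >].

Lemma is1P (G : group) (g : G) : reflect (g = gone) (is1 g).
Proof. exact: asboolP. Qed.

Lemma is1_gone (G : group) : is1 (gone : G).
Proof. exact/is1P. Qed.

Definition reduced2 p q := ~~ is1 p.2 && ~~ is1 q.1.
(* Only the first [A]-letter and the last [B]-letter of a reduced word may be
   trivial; every element of the free product has exactly one such form. *)
Definition reduced x := (x != [::] :> seq {classic (A * B)}) && sorted reduced2 x.

Lemma reducedP p w : reduced (p :: w) = path reduced2 p w.
Proof. by []. Qed.

(** Left multiplication on normal forms, as in van der Waerden's argument. Words that are not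
    reduced stay fixed, which makes this an action on all words. *)
Definition aact (a : A) x : seq (A * B) :=
  if x is (a1, b1) :: w then if reduced x then (gmul a a1, b1) :: w else x else x.

(** A head letter that becomes trivial is dropped, unless it is the only one: the identity has the
    normal form [[:: (gone, gone)]]. *)
Definition bact (b : B) x : seq (A * B) :=
  if x is (a1, b1) :: w then
    if reduced x then
      if is1 a1 then
        if is1 (gmul b b1) then (if w is [::] then [:: (gone, gone)] else w)
        else (gone, gmul b b1) :: w
      else if is1 b then x else (gone, b) :: x
    else x
  else x.

Lemma path_head a a' b w : path reduced2 (a, b) w = path reduced2 (a', b) w.
Proof. by case: w. Qed.

Lemma reduced_bact b x : reduced (bact b x) = reduced x.
Proof.
case: x => [|[a1 b1] w] //=; case: ifP => //; rewrite !reducedP => rx.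
case: ifP => [/is1P a1E|na1].
  case: ifP => [_|nb]; first by case: w rx => //= q w /andP[].
  rewrite reducedP; case: w rx => //= q w; rewrite /reduced2 /=.
  by move=> /andP[/andP[_ ->] ->]; rewrite nb.
case: ifP => [//|nb]; rewrite reducedP /= rx andbT /reduced2 /=.
by rewrite nb na1.
Qed.

Lemma aactM a a' x : aact a (aact a' x) = aact (gmul a a') x.
Proof.
case: x => [|[a1 b1] w] //=; case: ifP => /= rx; last by rewrite rx.
by rewrite reducedP (path_head _ a1) -reducedP rx gmulA.
Qed.

Lemma aact1 x : aact gone x = x.
Proof. by case: x => [|[a1 b1] w] //=; rewrite gmul1l if_same. Qed.

Lemma bact1 x : bact gone x = x.
Proof.
case: x => [|[a1 b1] w] //=; case: ifP => // rx; rewrite gmul1l is1_gone.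
case: ifP => // /is1P ->; case: ifP => // b1E; rewrite (is1P _ b1E).
by move: rx; rewrite reducedP; case: w => //= q w /andP[]; rewrite /reduced2 /= b1E.
Qed.

Lemma bactM b b' x : bact b (bact b' x) = bact (gmul b b') x.
Proof.
have [rx|rx] := boolP (reduced x); last first.
  have nb c : bact c x = x by case: x rx => [|[a1 b1] w] //= /negPf ->.
  by rewrite !nb.
have := reduced_bact b' x; rewrite rx.
case: x rx => [|[a1 b1] w] // rx; rewrite /= rx.
have [a1E|na1] := ifP; last first.
  case: ifP => [/is1P ->|nb' _]; first by rewrite /= rx na1 gmul1r.
  rewrite /= reducedP /= /reduced2 /= nb' na1 -reducedP rx /= is1_gone.
  by case: ifP.
case: ifP => [/is1P bb1|nbb1]; last first.
  by move=> r'; rewrite /= r' is1_gone gmulA.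
rewrite -gmulA bb1 gmul1r.
(* The head letter has cancelled. Since the word was reduced, the next [A]-letter is nontrivial, so
   [b] is put in front as a new letter. *)
case: w rx => [|[a2 b2] w] rx r' /=; first by rewrite is1_gone gmul1r.
rewrite r'; move: rx; rewrite reducedP /= /reduced2 /= => /andP[/andP[_ /negPf ->] _].
by [].
Qed.

Definition ev W x := foldr (fun p y => aact p.1 (bact p.2 y)) x W.

Lemma ev_cat u v x : ev (u ++ v) x = ev u (ev v x).
Proof. exact: foldr_cat. Qed.

Lemma ev_deletel a1 a2 b v x :
  ev [:: (a1, gone), (a2, b) & v] x = ev ((gmul a1 a2, b) :: v) x.
Proof. by rewrite /= bact1 aactM. Qed.

Lemma ev_deleter a b1 b2 v x :
  ev [:: (a, b1), (gone, b2) & v] x = ev ((a, gmul b1 b2) :: v) x.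
Proof. by rewrite /= aact1 bactM. Qed.

Lemma evK W : cancel (ev W) (ev (winv W)).
Proof.
elim: W => [|[a b] W IH] x //=; rewrite ev_cat /=.
by rewrite bact1 aactM gmulVl !aact1 bactM gmulVl bact1 IH.
Qed.

Lemma evKV W : cancel (ev (winv W)) (ev W).
Proof.
elim: W => [|[a b] W IH] x //=; rewrite ev_cat /= IH.
by rewrite aact1 bactM gmulVr bact1 bact1 aactM gmulVr aact1.
Qed.

Lemma ev_winvK W : ev (winv (winv W)) = ev W.
Proof. by apply/funext => x; rewrite -{1}[x](evK W) evK. Qed.

(** Uniqueness of normal forms follows: a reduced word can be read off from its action. *)
Lemma ev_reduced W : reduced W -> ev W [:: (gone, gone)] = W.
Proof.
elim: W => // -[a b] [|[a2 b2] W] IH rW.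
  rewrite /= !is1_gone gmul1r; case: ifP => [/is1P ->|_] /=; by rewrite gmul1r.
move: (rW); rewrite reducedP [path _ _ _]/= => /andP[/andP[/= nb na2] rW'].
rewrite -[LHS]/(aact a (bact b (ev ((a2, b2) :: W) [:: (gone, gone)]))) IH //.
rewrite /= reducedP rW' (negPf na2) (negPf nb) /=.
by rewrite reducedP /= rW' /reduced2 /= nb na2 gmul1r.
Qed.

Lemma unsorted_split (T : Type) (r : rel T) (s : seq T) : ~~ sorted r s ->
  exists s1 a b s2, s = s1 ++ [:: a, b & s2] /\ ~~ r a b.
Proof.
case: s => // a s; elim: s a => [|b s IH] a //=.
rewrite negb_and; case: (boolP (r a b)) => [_ /= /IH[s1 [c [d [s2 [E H]]]]]|H _].
  by exists (a :: s1), c, d, s2; rewrite E.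
by exists [::], a, b, s.
Qed.

(** Where the word fails to be reduced, a rotation brings the two letters concerned to the front and
    a deletion lemma merges them without raising [k]; the length drops. *)
Lemma has_diagram_reduce W k : W <> [::] -> has_diagram W k ->
  exists W', [/\ reduced W', has_diagram W' k & forall x, ev W' x = ev W x].
Proof.
have [n] := ubnP (size W); elim: n W => // n IH W sW W0 HW.
have [rW|rW] := boolP (reduced W); first by exists W.
have {rW} : ~~ sorted reduced2 W by case: (W) W0 rW.
case/unsorted_split => u [[a1 b1] [[a2 b2] [v [E nr]]]].
suff [V [sV V0 HV eV]] : exists V, [/\ size V < size W, V <> [::], has_diagram V k
    & forall x, ev V x = ev W x].
  have [|W' [r' H' e']] := IH V _ V0 HV; first by apply: leq_trans sV _; rewrite -ltnS.
  by exists W'; split=> // x; rewrite e'.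
move: HW; rewrite E => /has_diagram_rot.
move: nr; rewrite negb_and !negbK /= => /orP[/is1P b1E|/is1P a2E].
- rewrite b1E => /has_diagram_deletel H.
  exists (u ++ (gmul a1 a2, b2) :: v); split.
  + by rewrite !size_cat /= ltn_add2l.
  + by case: (u).
  + exact: (@has_diagram_rot _ _ (_ :: v)).
  + by move=> x; rewrite !ev_cat ev_deletel.
- rewrite a2E => /has_diagram_deleter H.
  exists (u ++ (a1, gmul b1 b2) :: v); split.
  + by rewrite !size_cat /= ltn_add2l.
  + by case: (u).
  + exact: (@has_diagram_rot _ _ (_ :: v)).
  + by move=> x; rewrite !ev_cat ev_deleter.
Qed.

(** * The free product of two groups, realised by the actions of words *)

Definition wordfun := ((seq (A * B) -> seq (A * B)) * (seq (A * B) -> seq (A * B)))%type.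
(** The action is stored with its inverse, so that inversion in the group merely swaps the
    components. *)
Definition is_word (f : wordfun) : Prop := exists W, f = (ev W, ev (winv W)).
Definition freeprod_sort : Type := {f : wordfun | is_word f}.

Lemma freeprod_eq (f g : freeprod_sort) : sval f = sval g -> f = g.
Proof.
case: f g => [f Hf] [g Hg] /= E; case: g / E Hg => Hg; congr exist.
exact: Prop_irrelevance.
Qed.

Lemma is_word_mul (f g : freeprod_sort) :
  is_word ((sval f).1 \o (sval g).1, (sval g).2 \o (sval f).2).
Proof.
have [W ->] := svalP f; have [V ->] := svalP g; exists (W ++ V); congr pair; apply/funext => x /=.
  by rewrite ev_cat.
by rewrite winv_cat ev_cat.
Qed.

Lemma is_word_one : is_word (id, id).
Proof. by exists [::]. Qed.

Lemma is_word_inv (f : freeprod_sort) : is_word ((sval f).2, (sval f).1).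
Proof. by have [W ->] := svalP f; exists (winv W); rewrite ev_winvK. Qed.

Definition freeprod_mul (f g : freeprod_sort) : freeprod_sort := exist _ _ (is_word_mul f g).
Definition freeprod_one : freeprod_sort := exist _ _ is_word_one.
Definition freeprod_inv (f : freeprod_sort) : freeprod_sort := exist _ _ (is_word_inv f).

Lemma freeprod_mulA f g h :
  freeprod_mul f (freeprod_mul g h) = freeprod_mul (freeprod_mul f g) h.
Proof. exact: freeprod_eq. Qed.
Lemma freeprod_mul1l f : freeprod_mul freeprod_one f = f.
Proof. by apply: freeprod_eq; case: f => [[]]. Qed.
Lemma freeprod_mul1r f : freeprod_mul f freeprod_one = f.
Proof. by apply: freeprod_eq; case: f => [[]]. Qed.
Lemma freeprod_mulVl f : freeprod_mul (freeprod_inv f) f = freeprod_one.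
Proof.
apply: freeprod_eq; rewrite /=; have [W ->] := svalP f.
by congr pair; apply/funext => x /=; rewrite evK.
Qed.
Lemma freeprod_mulVr f : freeprod_mul f (freeprod_inv f) = freeprod_one.
Proof.
apply: freeprod_eq; rewrite /=; have [W ->] := svalP f.
by congr pair; apply/funext => x /=; rewrite evKV.
Qed.

Definition freeprod : group :=
  @Group _ _ _ _ freeprod_mulA freeprod_mul1l freeprod_mul1r freeprod_mulVl freeprod_mulVr.

Definition of_word W : freeprod := exist _ (ev W, ev (winv W)) (ex_intro _ W erefl).

Lemma of_word_surj (f : freeprod) : exists W, f = of_word W.
Proof. by case: f => [f [W E]]; exists W; apply: freeprod_eq. Qed.

Lemma of_word_cat u v : of_word (u ++ v) = gmul (of_word u) (of_word v).
Proof.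
by apply: freeprod_eq; congr pair; apply/funext => x /=; rewrite ?winv_cat ev_cat.
Qed.

Lemma of_word_inv u : of_word (winv u) = ginv (of_word u).
Proof. by apply: freeprod_eq; rewrite /= ev_winvK. Qed.

Lemma of_word_ext u v : (forall x, ev u x = ev v x) -> of_word u = of_word v.
Proof.
move/funext => E; apply: freeprod_eq; congr pair => //=; apply/funext => x.
by rewrite -{1}[x](evKV v) -E evK.
Qed.

Lemma injl_subproof (a a' : A) :
  of_word [:: (gmul a a', gone)] = gmul (of_word [:: (a, gone)]) (of_word [:: (a', gone)]).
Proof. by rewrite -of_word_cat; apply: of_word_ext => x; rewrite ev_deletel. Qed.

Lemma injr_subproof (b b' : B) :
  of_word [:: (gone, gmul b b')] = gmul (of_word [:: (gone, b)]) (of_word [:: (gone, b')]).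
Proof. by rewrite -of_word_cat; apply: of_word_ext => x; rewrite ev_deleter. Qed.

Definition injl : hom A freeprod := @Hom A freeprod _ injl_subproof.
Definition injr : hom B freeprod := @Hom B freeprod _ injr_subproof.

(** Built from the disc by adding one handle per commutator. *)
Lemma of_word_prod_comm (l : list (freeprod * freeprod)) :
  exists W, [/\ W <> [::], has_diagram W (length l) & of_word W = prod_comm l].
Proof.
elim: l => [|[f g] l [W [W0 HW EW]]].
  exists [:: (gone, gone)]; split=> //; first exact: has_diagram1.
  by apply: freeprod_eq; congr pair; apply/funext => x /=; rewrite ?inv_one !(bact1, aact1).
have [X ->] := of_word_surj f; have [Y ->] := of_word_surj g.
exists (winv X ++ winv Y ++ X ++ Y ++ W); split.
- by move/(congr1 size); rewrite !size_cat; case: (W) W0 => //= *; lia.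
- exact: has_diagram_comm.
- rewrite !of_word_cat !of_word_inv EW.
  by rewrite -[RHS]/(gmul (comm _ _) (prod_comm l)) /comm -!gmulA.
Qed.

(** The word built from the commutators is reduced without raising [k], and by uniqueness of normal
    forms the result is [W] itself. *)
Lemma diagram_of_prod_comm (l : list (freeprod * freeprod)) W :
  reduced W -> prod_comm l = of_word W -> has_diagram W (length l).
Proof.
move=> rW; have [V [V0 HV <-]] := of_word_prod_comm l.
have [V' [rV' HV' E]] := has_diagram_reduce V0 HV.
move/(congr1 (fun f : freeprod => (sval f).1 [:: (gone, gone)])) => /=.
by rewrite -E !ev_reduced // => <-.
Qed.

End Words.

(** * Counting good orbits of powers of a commutator *)

Lemma div_ord_ge m c (o : option nat) :
  (if o is Some d then 0 < d /\ c * d <= m else c = 0) -> c <= div_ord m o.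
Proof.
case: o => [d [d0 le_m]|-> //]; apply/leP; apply: PeanoNat.Nat.div_le_lower_bound; lia.
Qed.

Lemma div_ord_add p u o1 o2 :
  (forall d, o1 = Some d -> 0 < d) -> ord_le o1 o2 ->
  div_ord p o1 + div_ord u o2 <= div_ord (p + u) o1.
Proof.
case: o1 => [d /(_ d erefl)|_]; case: o2 => [d'|] //= d0 le_d; apply/leP;
  apply: PeanoNat.Nat.div_le_lower_bound; try lia.
  have := PeanoNat.Nat.Div0.mul_div_le p d; have := PeanoNat.Nat.Div0.mul_div_le u d'; nia.
by have := PeanoNat.Nat.Div0.mul_div_le p d; lia.
Qed.

Section Counting.
Variables (Gam : group) (I : finType) (s : {perm I}) (lab : I -> Gam).
Variables (E : {set I}) (sg : pred I) (g : Gam) (o : option nat).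
Hypothesis s_fix : forall i, i \notin E -> s i = i.
Hypothesis labE : forall i, i \in E -> lab i = if sg i then g else ginv g.
Hypothesis ordg : has_order g o.

Definition turns (b b' : bool) : {set I} := [set i in E | (sg i == b) && (sg (s i) == b')].

Lemma perm_stable i : (s i \in E) = (i \in E).
Proof.
apply/idP/idP => iE; apply: contraLR iE => iE; first by rewrite s_fix.
by have /perm_inj <- := s_fix iE.
Qed.

Lemma trivIset_porbits : trivIset (porbits s).
Proof.
apply/trivIsetP => _ _ /imsetP[x _ ->] /imsetP[y _ ->]; apply: contraNT.
case/pred0Pn => z /= /andP[]; rewrite -!eq_porbit_mem => /eqP zx /eqP zy.
by rewrite -zx zy.
Qed.

Lemma pow_order_gt0 L : 0 < L -> gpow g L = gone ->
  if o is Some d then 0 < d /\ d <= L else False.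
Proof.
move=> L0 gL; move: ordg; case: (o) => [d [d0 [_ dmin]]|H]; last by apply: (H L) gL; lia.
split; first by lia.
by rewrite leqNgt; apply/negP => lt; apply: (dmin L) gL; lia.
Qed.

(** All labels on such an orbit are equal, so triviality of their product forces its length to be at
    least the order of [g]; distinct orbits are disjoint. *)
Lemma constant_orbits b :
  #|[set C in good_orbits s lab | C \subset turns b b]| <= div_ord #|turns b b| o.
Proof.
set F := [set C in _ | _].
have key C : C \in F -> if o is Some d then 0 < d /\ d <= #|C| else False.
  rewrite !inE => /andP[/andP[/imsetP[x _ ->] /asboolP[h hP]] /subsetP sub].
  apply: pow_order_gt0; first by rewrite lt0n card_porbit_neq0.
  pose y := if b then g else ginv g.
  have labC i : i \in porbit s x -> lab i = y.
    by move/sub; rewrite inE => /and3P[iE /eqP sgi _]; rewrite labE // sgi.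
  have hX k : h (iter k s x) = gmul (h x) (gpow y k).
    elim: k => [|k IH]; first by rewrite /= gmul1r.
    rewrite iterS hP; last by rewrite -permX mem_porbit.
    by rewrite labC ?IH -?gmulA -?pow_succ_r // -permX mem_porbit.
  have := hX #|porbit s x|; rewrite iter_porbit -{1}(gmul1r _ (h x)) => /mul_cancel_l.
  rewrite /y; case: (b) => // /esym; rewrite pow_inv => H.
  by rewrite -[gpow _ _]inv_inv H inv_one.
have cF : \sum_(C in F) #|C| <= #|turns b b|.
  have triv : trivIset F.
    by apply: trivIsetS trivIset_porbits; apply/subsetP => C; rewrite !inE => /andP[/andP[]].
  rewrite (eqP triv); apply: subset_leq_card; apply/bigcupsP => C.
  by rewrite inE => /andP[].
apply: div_ord_ge; move: ordg key; case: (o) => [d [d0 _]|_] key.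
  split; first by lia.
  by rewrite -sum_nat_const; apply: leq_trans cF; apply: leq_sum => C /key[].
by apply/eqP; rewrite cards_eq0; apply/eqP/setP => C; rewrite [RHS]inE; apply/negP => /key.
Qed.

(** A good orbit meets the complement of [E], or contains a change from negative to positive sign,
    or has constant sign. *)
Lemma ngood_le : ngood s lab <= #|~: E| + #|turns false true| +
  (div_ord #|turns true true| o + div_ord #|turns false false| o).
Proof.
set F0 := porbit s @: ~: E; set F1 := porbit s @: turns false true.
pose F b := [set C in good_orbits s lab | C \subset turns b b].
have cov : good_orbits s lab \subset F0 :|: F1 :|: (F true :|: F false).
  apply/subsetP => C CG; have /imsetP[x _ Cx] : C \in porbits s.
    by move: CG; rewrite inE => /andP[].
  rewrite !in_setU.
  have memC i : i \in C -> C = porbit s i.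
    by move=> iC; apply: porbits_mem => //; rewrite Cx imset_f.
  have stepC i : i \in C -> s i \in C by rewrite Cx; apply: porbit_step.
  have [[i /andP[iC iE]]|noE] := pselect (exists i, (i \in C) && (i \notin E)).
    by rewrite (memC i iC) imset_f // inE.
  have CE i : i \in C -> i \in E.
    by move=> iC; apply: contraT => iE; case: noE; exists i; rewrite iC.
  have [[i /andP[iC it]]|noT] := pselect (exists i, (i \in C) && (i \in turns false true)).
    by rewrite (memC i iC) [X in _ || X || _]imset_f ?orbT.
  have noup i : i \in C -> sg i = false -> sg (s i) = false.
    move=> iC si; apply/negP => ssi; case: noT; exists i.
    by rewrite iC inE CE // si ssi.
  have [[i /andP[iC si]]|nof] := pselect (exists i, (i \in C) && ~~ sg i).
    apply/orP; right; apply/orP; right; rewrite inE CG; apply/subsetP => j jC.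
    have allf k : k \in C -> sg k = false.
      rewrite (memC i iC); move: k.
      suff: forall k, k \in porbit s i -> k \in C /\ sg k = false.
        by move=> + k => /(_ k) + H => /(_ H)[].
      apply: porbit_ind; first by split=> //; apply/negbTE.
      by move=> k [kC sk]; split; [apply: stepC | apply: noup].
    by rewrite inE CE // !allf // stepC.
  have allt k : k \in C -> sg k = true.
    by move=> kC; apply: contraT => sk; case: nof; exists k; rewrite kC.
  apply/orP; right; apply/orP; left; rewrite inE CG; apply/subsetP => j jC.
  by rewrite inE CE // !allt // stepC.
rewrite /ngood; apply: leq_trans (subset_leq_card cov) _.
apply: leq_trans (leq_card_setU _ _).1 _; apply: leq_add.
  by apply: leq_trans (leq_card_setU _ _).1 _; apply: leq_add; apply: leq_imset_card.
by apply: leq_trans (leq_card_setU _ _).1 _; apply: leq_add; apply: constant_orbits.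
Qed.

Lemma turns_out b : #|turns b true| + #|turns b false| = #|[set i in E | sg i == b]|.
Proof.
rewrite -[RHS](cardsID (s @^-1: [set i | sg i])); congr (_ + _); apply: eq_card => i; rewrite !inE.
  by rewrite -andbA eqb_id.
by rewrite eqbF_neg andbA andbC.
Qed.

Lemma turns_in b : #|turns true b| + #|turns false b| = #|[set i in E | sg i == b]|.
Proof.
rewrite -(card_preimset [set i in E | sg i == b] (@perm_inj _ s)).
rewrite -[RHS](cardsID [set i | sg i]); congr (_ + _); apply: eq_card => i;
  rewrite !inE perm_stable ?eqb_id ?eqbF_neg.
  by rewrite -andbA; congr (_ && _); rewrite andbC.
by rewrite andbCA.
Qed.
End Counting.

(** * The alternating word of a power of a commutator, and the count for its diagrams *)

Section CommWord.
Variables (A B : group) (a : A) (t : B).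

Fixpoint comm_word n : seq (A * B) :=
  if n is m.+1 then [:: (ginv a, ginv t), (a, t) & comm_word m] else [::].

Lemma size_comm_word n : size (comm_word n) = n.*2.
Proof. by elim: n => //= n ->. Qed.

Lemma nth_comm_word n j p0 : j < n.*2 ->
  nth p0 (comm_word n) j = if odd j then (a, t) else (ginv a, ginv t).
Proof.
elim: n j => // n IH [|[|j]] //= lt_j; rewrite negbK IH //; lia.
Qed.

Lemma is1_inv (G : group) (g : G) : is1 (ginv g) = is1 g.
Proof. by apply/is1P/is1P => [gE|->]; rewrite ?inv_one // -[g]inv_inv gE inv_one. Qed.

Lemma reduced_comm_word n : a <> gone -> t <> gone -> 0 < n -> reduced (comm_word n).
Proof.
move=> /is1P na /is1P nt; case: n => // n _; rewrite reducedP.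
elim: n => [|n IH]; first by rewrite /= /reduced2 /= is1_inv nt na.
by move: IH; rewrite /= /reduced2 /= !is1_inv !nt !na.
Qed.

Lemma hom_one (G H : group) (f : hom G H) : f gone = gone.
Proof. by apply: (@mul_cancel_l _ (f gone)); rewrite -hmapM !gmul1r. Qed.

Lemma hom_inv (G H : group) (f : hom G H) x : f (ginv x) = ginv (f x).
Proof. by apply: inv_unique; rewrite -hmapM gmulVr hom_one. Qed.

Lemma of_word1 (x : A) (y : B) : of_word [:: (x, y)] = gmul (injl A B x) (injr A B y).
Proof.
rewrite -of_word_cat; apply: of_word_ext => z.
by rewrite -[_ ++ _]/[:: (x, gone); (gone, y)] ev_deleter gmul1l.
Qed.

Lemma of_comm_word n :
  of_word (comm_word n) = gpow (comm (injl A B a) (injr A B t)) n.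
Proof.
elim: n => [|n IH]; first by apply: freeprod_eq.
rewrite -[comm_word _]/([:: (ginv a, ginv t)] ++ [:: (a, t)] ++ comm_word n).
rewrite !of_word_cat IH !of_word1 !hom_inv.
by rewrite -[RHS]/(gmul (comm _ _) (gpow _ n)) /comm -!gmulA.
Qed.

(** Even length makes the parity alternate at the wrap-around as well. *)
Lemma index_next (T : eqType) (e : seq T) x n : uniq e -> size e = n.*2 -> x \in e ->
  odd (index (next e x) e) = ~~ odd (index x e).
Proof.
move=> Ue se xe; rewrite next_nth xe; case: e Ue se xe => // y p Ue se xe.
have := xe; rewrite -index_mem ltnS leq_eqVlt => /orP[/eqP ix|lt_x].
  by rewrite nth_default ix // index_head -[~~ _]/(odd (size (y :: p))) se odd_double.
by rewrite -[nth y p _]/(nth y (y :: p) (index x (y :: p)).+1) index_uniq.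
Qed.

Lemma comm_word_bound n k oa ot :
  has_order a oa -> has_order t ot -> ord_le oa ot ->
  has_diagram (comm_word n) k -> n + 1 <= k.*2 + (div_ord n oa).*2.
Proof.
move=> Hoa Hot Hle /(_ 0)[I [e [la [lb [al [be [D eW _]]]]]]].
have be_fix i := @be_notin _ _ _ _ _ _ _ _ _ i D.
case: D => Ue fe ne ce.
have se : size e = n.*2 by rewrite -(size_comm_word n) -eW size_map.
pose E := [set i in e]; pose sg i := odd (index i e).
have lab_e i : i \in E -> (la i, lb i) = if sg i then (a, t) else (ginv a, ginv t).
  rewrite inE => ie; have lt_i : index i e < size e by rewrite index_mem.
  rewrite -(@nth_comm_word n _ (la i, lb i)) -?se // -eW.
  by rewrite (nth_map i) // nth_index.
have la_e i : i \in E -> la i = if sg i then a else ginv a.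
  by move/lab_e; case: (sg i) => -[].
have lb_e i : i \in E -> lb i = if sg i then t else ginv t.
  by move/lab_e; case: (sg i) => -[].
have al_fix i : i \notin E -> al i = i by rewrite inE => /fe[].
have be_fixE i : i \notin E -> be i = i by rewrite inE => /be_fix; apply.
have sg_next i : i \in E -> sg (al (be i)) = ~~ sg i.
  by rewrite inE ne /sg => ie; rewrite (index_next Ue se).
have cE : #|E| = n.*2 by rewrite cardsE (card_uniqP Ue).
(* The cyclic shift exchanges positive and negative indices. *)
have half b : #|[set i in E | sg i == b]| = n.
  have eqb b' : #|[set i in E | sg i == b']| = #|[set i in E | sg i == ~~ b']|.
    rewrite -(card_preimset [set i in E | sg i == b'] (@perm_inj _ (be * al)%g)).
    apply: eq_card => i; rewrite !inE permM -[al _ \in e]/(_ \in e).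
    have -> : (al (be i) \in e) = (i \in e) by rewrite ne mem_next.
    case: (boolP (i \in e)) => //= ie; rewrite sg_next ?inE //.
    by case: (sg i) (b') => -[].
  have : #|[set i in E | sg i == true]| + #|[set i in E | sg i == false]| = n.*2.
    rewrite -cE -[RHS](cardsID [set i | sg i]); congr (_ + _); apply: eq_card => i;
      rewrite !inE ?eqb_id ?eqbF_neg //; exact: andbC.
  by rewrite -(eqb true); have := eqb true; case: b => /=; lia.
have Ga := ngood_le al la_e Hoa; have Gb := ngood_le be lb_e Hot.
have oT := turns_out al E sg; have iT := turns_in sg al_fix.
have oT' := turns_out be E sg; have iT' := turns_in sg be_fixE.
(* Since [al \o be] reverses signs, [be] raises the sign at [i] exactly when [al] keeps a positive
   sign at [be i]. Hence the sign-raising turns of [al] and [be] together number [n], and so do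
   their turns that keep a positive sign. *)
have swap : #|turns be E sg false true| = #|turns al E sg true true|.
  rewrite -(card_preimset (turns al E sg true true) (@perm_inj _ be)); apply: eq_card => i.
  have := perm_stable be_fixE i; rewrite !inE => ->.
  case: (boolP (i \in e)) => //= ie.
  by rewrite sg_next ?inE //; case: (sg i); case: (sg _).
have := half true; have := half false => hf ht.
have := oT true; have := oT false; have := iT true; have := iT false.
have := oT' true; have := oT' false; have := iT' true; have := iT' false.
rewrite !hf !ht => {oT iT oT' iT'} b1 b2 b3 b4 a1 a2 a3 a4.
have cI : #|~: E| + n.*2 = #|I| by rewrite -cE addnC cardsC.
have d0 d : oa = Some d -> 0 < d by move=> oaE; move: Hoa; rewrite oaE => -[+ _]; lia.
have := @div_ord_add #|turns al E sg true true| #|turns be E sg true true| oa ot d0 Hle.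
have -> : #|turns al E sg true true| + #|turns be E sg true true| = n by lia.
have Ea : #|turns al E sg false false| = #|turns al E sg true true| by lia.
have Eb : #|turns be E sg false false| = #|turns be E sg true true| by lia.
rewrite Ea in Ga; rewrite Eb in Gb; move: Ga Gb ce; rewrite se; lia.
Qed.

End CommWord.

(** * Transfer along homomorphisms and projection to two factors *)

Lemma prod_comm_hom (G H : group) (f : hom G H) (l : list (G * G)) :
  f (prod_comm l) = prod_comm [seq (f p.1, f p.2) | p <- l].
Proof.
elim: l => [|[x y] l IH] /=; first exact: hom_one.
by rewrite hmapM IH /comm !hmapM !hom_inv.
Qed.

Lemma gpow_hom (G H : group) (f : hom G H) x n : f (gpow x n) = gpow (f x) n.
Proof. by elim: n => [|n IH] /=; rewrite ?hom_one // hmapM IH. Qed.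

Lemma comm_hom (G H : group) (f : hom G H) x y : f (comm x y) = comm (f x) (f y).
Proof. by rewrite /comm !hmapM !hom_inv. Qed.

Lemma trivial_hom_subproof (G H : group) (x y : G) : gone = gmul gone gone :> H.
Proof. by rewrite gmul1l. Qed.

Definition trivial_hom (G H : group) : hom G H :=
  @Hom G H (fun=> gone) (@trivial_hom_subproof G H).

Section Projection.
Variables (J : Type) (A : J -> group) (G : group) (inj : forall j, hom (A j) G).
Hypothesis HG : is_free_product J A G inj.
Variables (j1 j2 : J).
Hypothesis Hj : j1 <> j2.

(** The universal property is applied to the two embeddings and to the trivial map on every other
    factor. Indices are compared classically. *)
Lemma free_product_proj : exists phi : hom G (freeprod (A j1) (A j2)),
  (forall x, phi (inj j1 x) = injl _ _ x) /\ (forall y, phi (inj j2 y) = injr _ _ y).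
Proof.
pose P := freeprod (A j1) (A j2).
pose f j : hom (A j) P :=
  match pselect (j1 = j) with
  | left e => match e in _ = j return hom (A j) P with erefl => injl _ _ end
  | right _ => match pselect (j2 = j) with
    | left e => match e in _ = j return hom (A j) P with erefl => injr _ _ end
    | right _ => trivial_hom _ _
    end
  end.
have [phi [phiE _]] := HG f; exists phi; split => x; rewrite phiE /f.
  by case: pselect => // e; rewrite (Prop_irrelevance e erefl).
case: pselect => // _; by case: pselect => // e; rewrite (Prop_irrelevance e erefl).
Qed.
End Projection.

Lemma comm_pow_lower (J : Type) (A : J -> group) (G : group)
    (inj : forall j, hom (A j) G) (j1 j2 : J) (a : A j1) (t : A j2)
    (oa ot : option nat) (n : nat) (l : list (G * G)) :
  is_free_product J A G inj -> j1 <> j2 -> (0 < n)%coq_nat -> a <> gone -> t <> gone ->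
  has_order a oa -> has_order t ot -> ord_le oa ot ->
  prod_comm l = gpow (comm (inj j1 a) (inj j2 t)) n ->
  (n + 1 <= 2 * length l + 2 * div_ord n oa)%coq_nat.
Proof.
move=> HG Hj /leP n0 na nt Hoa Hot Hle El.
have [phi [phi1 phi2]] := free_product_proj HG Hj.
suff : n + 1 <= (length l).*2 + (div_ord n oa).*2 by lia.
apply: (comm_word_bound Hoa Hot Hle).
rewrite -[length l](size_map (fun p => (phi p.1, phi p.2))).
apply: diagram_of_prod_comm; first exact: reduced_comm_word.
by rewrite of_comm_word -prod_comm_hom El gpow_hom comm_hom phi1 phi2.
Qed.

End LowerBound.

Theorem theorem3 (J : Type) (A : J -> group) (G : group)
    (inj : forall j, hom (A j) G)
    (HG : is_free_product J A G inj)
    (Hnt : forall j, nontrivial (A j))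
    (n : nat) (Hn : 0 < n)
    (j1 j2 : J) (Hj : j1 <> j2)
    (a : A j1) (t : A j2) (Ha : a <> gone) (Ht : t <> gone)
    (oa ot : option nat) (Hoa : has_order a oa) (Hot : has_order t ot)
    (Hle : ord_le oa ot) :
  comm_length (gpow (comm (inj j1 a) (inj j2 t)) n)
              (n / 2 - div_ord n oa + 1).
Proof.
  assert (Ho : forall m, oa = Some m -> 2 <= m /\ gpow (inj j1 a) m = gone).
  { intros m ->; destruct Hoa as (Hm & Hpow & _); split.
    - destruct m as [|[|m]]; [lia| |lia].
      now rewrite pow_1 in Hpow.
    - rewrite <- LowerBound.gpow_hom, Hpow; apply LowerBound.hom_one. }
  split.
  - destruct oa as [m|]; simpl div_ord.
    + destruct (Ho m eq_refl) as [Hm Hpow]; now apply comm_pow_upper.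
    + rewrite Nat.sub_0_r; now apply comm_pow_upper_inf.
  - intros l Hl.
    assert (H := LowerBound.comm_pow_lower HG Hj Hn Ha Ht Hoa Hot Hle Hl).
    change (n + 1 <= 2 * length l + 2 * div_ord n oa) in H.
    assert (Hn2 := Nat.div_mod n 2 ltac:(lia)).
    assert (Hr2 := Nat.mod_upper_bound n 2 ltac:(lia)).
    (* The order is at least 2, so the truncated subtraction in the formula is exact. *)
    assert (Hdiv : div_ord n oa <= n / 2).
    { destruct oa as [m|]; simpl div_ord; [|apply Nat.le_0_l].
      apply Nat.div_le_compat_l; destruct (Ho m eq_refl); lia. }
    lia.
Qed.
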